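(* Let $G$ be a bipartite Borel graph with finite asymptotic separation index. Then $\chi'_B(G)\leq \Delta(G)+\mathrm{asi}(G)$.
   Context: A Borel graph on a Polish space $X$ is a graph with vertex set $X$ whose edge set is a Borel subset of $X^2$ (symmetric and irreflexive). Bipartite means having no odd cycles. $\Delta(G)$ is the maximum degree. The Borel edge chromatic number $\chi'_B(G)$ is the least cardinal $\kappa$ such that $G$ admits a Borel proper edge coloring (edges sharing a vertex get distinct colors) with $\kappa$ colors. A Borel graph is component finite if all its connected components are finite. For $r\in\omega$, $G^{\leq r}$ is the Borel graph on $X$ in which two distinct points are adjacent iff their path distance in $G$ is at most $r$. For a locally finite Borel graph $G$ and $s\in\omega$, $\mathrm{asi}(G)\leq s$ means: for every $r\in\omega$ there are Borel sets $U_0,\dots,U_s$ covering $X$ such that $G^{\leq r}\upharpoonright U_i$ is component finite for each $i$. $\mathrm{asi}(G)$ is the least such $s$ (finite asymptotic separation index means some such $s\in\omega$ exists). *)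

(* Defs.v *)
From mathcomp Require Import all_boot all_order all_algebra.
From mathcomp Require Import all_classical all_reals all_analysis.

Set Implicit Arguments.
Unset Strict Implicit.
Unset Printing Implicit Defensive.

Import Order.TTheory GRing.Theory Num.Theory.

Local Open Scope classical_set_scope.
Local Open Scope card_scope.
Local Open Scope ring_scope.

(* The empty space counts as Polish, which is why the pointed structures of the
   library (completePseudoMetricType, measurableType) are not used here. *)

Definition is_metric (R : realType) (X : Type) (d : X -> X -> R) : Prop :=
  [/\ forall x y, 0 <= d x y,
      forall x y, d x y = 0 <-> x = y,
      forall x y, d x y = d y x &
      forall x y z, d x z <= d x y + d y z].

Definition metrizes (R : realType) (X : topologicalType) (d : X -> X -> R) :
    Prop :=
  forall x : X,
    nbhs x = filter_from [set e : R | 0 < e] (fun e => [set y | d x y < e]).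

Definition complete_metric (R : realType) (X : topologicalType)
    (d : X -> X -> R) : Prop :=
  forall u : nat -> X,
    (forall e : R, 0 < e ->
       exists N, forall m n, (N <= m)%N -> (N <= n)%N -> d (u m) (u n) < e) ->
    exists x : X, u @ \oo --> x.

Definition separable (X : topologicalType) : Prop :=
  exists D : set X, countable D /\ dense D.

Definition polish_space (R : realType) (X : topologicalType) : Prop :=
  separable X /\
  exists d : X -> X -> R, [/\ is_metric d, metrizes d & complete_metric d].

Definition borel (X : topologicalType) (A : set X) : Prop := <<s open >> A.

(* A graph with vertex set X is given by its set of ordered pairs of adjacent
   points, the topology on X * X being the product topology. *)
Definition borel_graph (X : topologicalType) (G : set (X * X)) : Prop :=
  [/\ borel G,
      forall x y, G (x, y) -> G (y, x) &
      forall x, ~ G (x, x)].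

Definition adj (X : Type) (G : set (X * X)) : rel X := fun x y => (x, y) \in G.

Definition neighbors (X : Type) (G : set (X * X)) (x : X) : set X :=
  [set y | G (x, y)].

Definition locally_finite (X : Type) (G : set (X * X)) : Prop :=
  forall x, finite_set (neighbors G x).

(* [ucycle] also accepts sequences of length 0 and 2, which are even; for an
   irreflexive G it accepts none of length 1. *)
Definition bipartite (X : choiceType) (G : set (X * X)) : Prop :=
  forall p : seq X, ucycle (adj G) p -> ~~ odd (size p).

Definition dist_le (X : Type) (G : set (X * X)) (r : nat) (x y : X) : Prop :=
  exists p : seq X, [/\ path (adj G) x p, last x p = y & (size p <= r)%N].

Definition graph_power (X : Type) (G : set (X * X)) (r : nat) : set (X * X) :=
  [set xy | xy.1 <> xy.2 /\ dist_le G r xy.1 xy.2].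

(* Points outside U become isolated, which does not affect whether all
   components are finite. *)
Definition restrict_graph (X : Type) (H : set (X * X)) (U : set X) :
    set (X * X) :=
  H `&` (U `*` U).

Definition component (X : Type) (H : set (X * X)) (x : X) : set X :=
  [set y | exists p : seq X, path (adj H) x p /\ last x p = y].

Definition component_finite (X : Type) (H : set (X * X)) : Prop :=
  forall x, finite_set (component H x).

Definition least (P : nat -> Prop) : nat :=
  xget 0%N [set n | P n /\ forall m, P m -> (n <= m)%N].

Definition asi_le (X : topologicalType) (G : set (X * X)) (s : nat) : Prop :=
  forall r : nat, exists U : 'I_s.+1 -> set X,
    [/\ forall i, borel (U i),
        \bigcup_i U i = [set: X] &
        forall i, component_finite (restrict_graph (graph_power G r) (U i))].

Definition finite_asi (X : topologicalType) (G : set (X * X)) : Prop :=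
  exists s, asi_le G s.

(* Meaningful only under [finite_asi G]; the value is 0 otherwise. *)
Definition asi (X : topologicalType) (G : set (X * X)) : nat :=
  least (asi_le G).

(* The cardinalities of Borel subsets of Polish spaces: the possible sizes of a
   vertex's neighborhood in a Borel graph and of a Borel set of colors. *)
Inductive borel_card : Type :=
  | Fin of nat
  | Aleph0
  | Continuum.

Definition card_add (k l : borel_card) : borel_card :=
  match k, l with
  | Fin m, Fin n => Fin (m + n)%N
  | Continuum, _ | _, Continuum => Continuum
  | _, _ => Aleph0
  end.

Definition card_leq (k l : borel_card) : Prop :=
  match k, l with
  | Fin m, Fin n => (m <= n)%N
  | Fin _, _ | Aleph0, Aleph0 | Aleph0, Continuum | Continuum, Continuum => True
  | _, _ => False
  end.

(* Least cardinal satisfying a property P that always holds of the continuum;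
   P is specified on the finite cardinals `I_n and on aleph_0 = [set: nat]. *)
Definition least_card (P : set nat -> Prop) : borel_card :=
  if `[< exists n, P `I_n >] then Fin (least (fun n => P `I_n))
  else if `[< P [set: nat] >] then Aleph0
  else Continuum.

(* For unbounded degrees this is the supremum of the degrees. *)
Definition max_degree (X : Type) (G : set (X * X)) : borel_card :=
  least_card (fun K => forall x, neighbors G x #<= K).

(* An edge coloring is a function of ordered pairs, constrained only on G,
   where it must be invariant under reversing the edge. *)
Definition borel_edge_coloring (X : topologicalType) (G : set (X * X))
    (K : set nat) (c : X * X -> nat) : Prop :=
  [/\ forall k, borel (G `&` c @^-1` [set k]),
      forall xy, G xy -> K (c xy),
      forall x y, G (x, y) -> c (x, y) = c (y, x) &
      forall x y z, G (x, y) -> G (x, z) -> y <> z -> c (x, y) <> c (x, z)].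

(* A Borel graph always has a Borel proper edge coloring with continuum many
   colors, as X embeds in the reals: hence the last case of [least_card]. *)
Definition borel_edge_chromatic_number (X : topologicalType)
    (G : set (X * X)) : borel_card :=
  least_card (fun K => exists c, borel_edge_coloring G K c).

(* Main.v *)
Require Import Defs.
From mathcomp Require Import all_boot all_order all_algebra.
From mathcomp Require Import all_classical all_reals all_analysis.
From mathcomp Require Import zify lra.

(* Let G have degrees at most d and let U 0, ..., U s cover X so that the
   components of a large power of G restricted to each U i are finite. The edges
   inside U 0 have a Borel coloring with d colors: on each finite component, use
   König's theorem. Each U i then costs one more color. Indeed, suppose that the
   edges inside W are colored with k colors, and consider the edges inside
   H = W u U i. By induction on k, one finds a matching P containing the last
   color class away from U i such that, outside P, the graph H has degrees at
   most k near U i and at most k - 1 elsewhere, while the edges away from U i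
   remain colored with k - 1 colors. The neighborhood of U i that counts as
   "near" grows by 2 at each step, and in the end the remaining edges form a
   matching, which gets the extra color.
   For these constructions to be Borel, one needs a locally finite Borel graph
   to be covered by countably many graphs of Borel functions, which is proved
   from Novikov's separation theorem for analytic sets. If the degrees are
   unbounded, this covering already yields a coloring with countably many
   colors. *)

Set Implicit Arguments.
Unset Strict Implicit.
Unset Printing Implicit Defensive.

Local Open Scope classical_set_scope.

(** * Borel and analytic sets *)

Section Borel.
Variable T : topologicalType.
Implicit Types A B : set T.

Lemma borel_open A : open A -> borel A.
Proof. exact: sub_sigma_algebra. Qed.

Lemma borelC A : borel A -> borel (~` A).
Proof. by rewrite -setTD; exact: sigma_algebraCD. Qed.

Lemma borel0 : borel (set0 : set T).
Proof. exact: sigma_algebra0. Qed.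

Lemma borel_bigcup (I : countType) (F : I -> set T) :
  (forall i, borel (F i)) -> borel (\bigcup_i F i).
Proof.
move=> bF.
have -> : \bigcup_i F i = \bigcup_n oapp F set0 (unpickle n).
  apply/seteqP; split=> [x [i _ Fi]|x [n _]] /=.
    by exists (pickle i) => //; rewrite pickleK.
  by case: (unpickle n) => //= i Fi; exists i.
by apply: sigma_algebra_bigcup => n; case: (unpickle n); last exact: borel0.
Qed.

Lemma borel_bigcap (I : countType) (F : I -> set T) :
  (forall i, borel (F i)) -> borel (\bigcap_i F i).
Proof.
move=> bF; rewrite -[X in borel X]setCK setC_bigcap.
by apply: borelC; apply: borel_bigcup => i; exact: borelC.
Qed.

Lemma borelU A B : borel A -> borel B -> borel (A `|` B).
Proof.
move=> bA bB; rewrite -bigcup2E; apply: borel_bigcup => -[|[|i]] //=.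
exact: borel0.
Qed.

Lemma borelI A B : borel A -> borel B -> borel (A `&` B).
Proof.
move=> bA bB; rewrite -[_ `&` _]setCK setCI.
by apply: borelC; apply: borelU; exact: borelC.
Qed.

Lemma borelD A B : borel A -> borel B -> borel (A `\` B).
Proof. by move=> bA bB; apply: borelI => //; exact: borelC. Qed.

Lemma borelT : borel (setT : set T).
Proof. by apply: borel_open; exact: openT. Qed.

Lemma borel_cst (P : Prop) : borel [set _ : T | P].
Proof.
have [p|np] := pselect P.
  by rewrite (_ : mkset _ = setT) ?predeqE //; exact: borelT.
by rewrite (_ : mkset _ = set0) ?predeqE //; exact: borel0.
Qed.

Lemma borel_exists (I : countType) (F : I -> set T) :
  (forall i, borel (F i)) -> borel [set x | exists i, F i x].
Proof.
move=> /borel_bigcup; congr borel.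
by apply/seteqP; split=> x [i]; [move=> _ Fi|move=> Fi]; exists i.
Qed.

Lemma borel_forall (I : countType) (F : I -> set T) :
  (forall i, borel (F i)) -> borel [set x | forall i, F i x].
Proof.
move=> /borel_bigcap; congr borel.
by apply/seteqP; split=> x Fx i; [exact: Fx|move=> _; exact: Fx].
Qed.

Lemma borel_imply A B : borel A -> borel B -> borel [set x | A x -> B x].
Proof.
move=> bA bB; rewrite (_ : mkset _ = ~` A `|` B).
  by apply: borelU => //; exact: borelC.
apply/seteqP; split=> [x /= AB|x [nA|Bx] //].
by have [/AB|] := pselect (A x); [right|left].
Qed.

End Borel.

Definition borel_fun (S T : topologicalType) (f : S -> T) :=
  forall A : set T, open A -> borel (f @^-1` A).

Lemma borel_preimage (S T : topologicalType) (f : S -> T) (A : set T) :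
  borel_fun f -> borel A -> borel (f @^-1` A).
Proof.
move=> bf; move: A; apply: smallest_sub; last by move=> A /bf.
split=> [|A bA|A bA]; first by rewrite /= preimage_set0; exact: borel0.
  by rewrite /= setTD preimage_setC; exact: borelC.
by rewrite /= preimage_bigcup; exact: borel_bigcup.
Qed.

Lemma borel_fun_comp (S T U : topologicalType) (f : S -> T) (g : T -> U) :
  borel_fun f -> borel_fun g -> borel_fun (g \o f).
Proof.
move=> bf bg A oA.
exact: (borel_preimage (A := g @^-1` A) bf (bg _ oA)).
Qed.

Lemma continuous_borel (S T : topologicalType) (f : S -> T) :
  continuous f -> borel_fun f.
Proof. by move=> /continuousP cf A /cf /borel_open. Qed.

Lemma hausdorff_open (T : topologicalType) (x y : T) :
  hausdorff_space T -> x <> y -> exists U V : set T,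
    [/\ open U, open V, U x, V y & forall z, U z -> ~ V z].
Proof.
move=> hT xy; apply: contrapT => nUV; apply: xy; apply: hT => U V.
rewrite !nbhsE => -[U' [oU U'x] UU'] [V' [oV V'y] VV'].
apply: contrapT => UV; apply: nUV; exists U', V'; split=> // z Uz Vz.
by apply: UV; exists z; split; [exact: UU'|exact: VV'].
Qed.

(** * Closed subsets of the Baire space and analytic sets *)

Definition agree (n : nat) (v w : nat -> nat) := forall i, i < n -> v i = w i.

Lemma agree_le m n v w : m <= n -> agree n v w -> agree m v w.
Proof. by move=> mn nvw i im; apply: nvw; apply: leq_trans mn. Qed.

Definition seq_closed (F : set (nat -> nat)) :=
  forall w, (forall n, exists2 v, F v & agree n v w) -> F w.

Definition seq_continuous (T : topologicalType) (F : set (nat -> nat))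
    (f : (nat -> nat) -> T) :=
  forall w U, F w -> nbhs (f w) U ->
    exists n, forall v, F v -> agree n v w -> U (f v).

(** Initial segments stand for the topology of the Baire space. The domain is an arbitrary closed
    set, possibly empty, so the empty set is analytic. *)
Definition analytic (T : topologicalType) (A : set T) :=
  exists F f, [/\ seq_closed F, seq_continuous F f & f @` F = A].

(** One point of the Baire space codes countably many points, read off along the pairing of
    indices. *)
Definition slice (i : nat) (w : nat -> nat) : nat -> nat :=
  fun j => w (pickle (i, j)).

Definition unslice (W : nat -> nat -> nat) : nat -> nat :=
  fun m => if unpickle m is Some (i, j) then W i j else 0.

Lemma slice_unslice W i : slice i (unslice W) = W i.
Proof. by apply/funext => j; rewrite /slice /unslice pickleK. Qed.

Lemma agree_slice i n : exists m, forall v w,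
  agree m v w -> agree n (slice i v) (slice i w).
Proof.
exists (\max_(j < n) pickle (i, val j)).+1 => v w vw j jn.
by apply: vw; rewrite ltnS; exact: (leq_bigmax (Ordinal jn)).
Qed.

Section Analytic.
Variable T : topologicalType.

(** The first entry of the parameter selects the set, the remaining entries parametrize it. *)
Lemma analytic_bigcup (A : nat -> set T) :
  (forall i, analytic (A i)) -> analytic (\bigcup_i A i).
Proof.
move=> /choice[F] /choice[f] Ff.
pose sh (w : nat -> nat) := fun j => w j.+1.
have shP n v w : agree n.+1 v w -> v 0 = w 0 /\ agree n (sh v) (sh w).
  by move=> vw; split=> [|i ni]; apply: vw.
exists [set w | F (w 0) (sh w)], (fun w => f (w 0) (sh w)); split.
- move=> w wF /=; have [cF _ _] := Ff (w 0); apply: cF => n.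
  by have [v Fv /shP[e vw]] := wF n.+1; exists (sh v); rewrite -?e.
- move=> w U Fw Uw; have [_ cf _] := Ff (w 0).
  have [n nU] := cf _ _ Fw Uw; exists n.+1 => v Fv /shP[e vw].
  by rewrite e; apply: nU; rewrite // -e.
- apply/seteqP; split=> [x [w Fw <-]|x [i _]].
    by exists (w 0) => //; have [_ _ <-] := Ff (w 0); exists (sh w).
  have [_ _ <-] := Ff i => -[w Fw <-].
  by exists (fun n => if n is n'.+1 then w n' else i).
Qed.

(** The parameters are the sequences all of whose slices have the same image; this is a closed
    condition because T is Hausdorff. *)
Lemma analytic_bigcap (A : nat -> set T) : hausdorff_space T ->
  (forall i, analytic (A i)) -> analytic (\bigcap_i A i).
Proof.
move=> hT /choice[F] /choice[f] Ff.
exists [set w | forall i, F i (slice i w) /\ f i (slice i w) = f 0 (slice 0 w)],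
  (fun w => f 0 (slice 0 w)); split.
- move=> w wF.
  have Fw i : F i (slice i w).
    have [cF _ _] := Ff i; apply: cF => n; have [m mn] := agree_slice i n.
    have [v Fv vw] := wF m; exists (slice i v); last exact: mn.
    by have [] := Fv i.
  move=> i; split=> //;
    apply: contrapT => /(hausdorff_open hT)[U [V [oU oV Uf Vf UV]]].
  have [_ ci _] := Ff i; have [_ c0 _] := Ff 0.
  have [n nU] := ci _ _ (Fw i) (open_nbhs_nbhs (conj oU Uf)).
  have [m mV] := c0 _ _ (Fw 0) (open_nbhs_nbhs (conj oV Vf)).
  have [n' nn'] := agree_slice i n; have [m' mm'] := agree_slice 0 m.
  have [v Fv vw] := wF (maxn n' m').
  have [Fi fi] := Fv i; have [F0 _] := Fv 0.
  apply: (UV (f 0 (slice 0 v))); [rewrite -fi; apply: nU|apply: mV] => //.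
    by apply/nn'/agree_le/vw; exact: leq_maxl.
  by apply/mm'/agree_le/vw; exact: leq_maxr.
- move=> w U Fw Uw; have [_ c0 _] := Ff 0; have [F0 _] := Fw 0.
  have [n nU] := c0 _ _ F0 Uw; have [m mn] := agree_slice 0 n.
  by exists m => v Fv /mn vw; apply: nU vw; have [] := Fv 0.
- apply/seteqP; split=> [x [w Fw <-] i _|x Ax].
    have [_ _ <-] := Ff i; have [Fi <-] := Fw i; by exists (slice i w).
  have /choice[W WP] : forall i, exists w, F i w /\ f i w = x.
    move=> i; have := Ax i I; have [_ _ <-] := Ff i => -[w ? ?].
    by exists w.
  exists (unslice W); last by rewrite slice_unslice; have [] := WP 0.
  move=> i /=; rewrite !slice_unslice.
  by have [? ->] := WP i; have [_ ->] := WP 0.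
Qed.

Lemma analytic_image (S : topologicalType) (A : set S) (g : S -> T) :
  continuous g -> analytic A -> analytic (g @` A).
Proof.
move=> cg [F [f [cF cf fA]]]; exists F, (g \o f); split=> //.
  by move=> w U Fw /cg /cf; exact.
by rewrite -image_comp fA.
Qed.

End Analytic.

Lemma analyticX (S T : topologicalType) (A : set S) (B : set T) :
  analytic A -> analytic B -> analytic (A `*` B).
Proof.
move=> [F [f [cF cf <-]]] [G [g [cG cg <-]]].
exists [set w | F (slice 0 w) /\ G (slice 1 w)],
  (fun w => (f (slice 0 w), g (slice 1 w))); split.
- move=> w wFG; split; [apply: cF|apply: cG] => n.
    have [m mn] := agree_slice 0 n; have [v [Fv _] /mn vw] := wFG m.
    by exists (slice 0 v).
  have [m mn] := agree_slice 1 n; have [v [_ Fv] /mn vw] := wFG m.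
  by exists (slice 1 v).
- move=> w U [Fw Gw] [[V W] /= [Vf Wg] VWU].
  have [n nV] := cf _ _ Fw Vf; have [m mW] := cg _ _ Gw Wg.
  have [n' nn'] := agree_slice 0 n; have [m' mm'] := agree_slice 1 m.
  exists (maxn n' m') => v [Fv Gv] vw; apply: VWU; split=> /=.
    by apply: nV => //; apply/nn'/agree_le/vw; exact: leq_maxl.
  by apply: mW => //; apply/mm'/agree_le/vw; exact: leq_maxr.
- apply/seteqP; split=> [_ [w [Fw Gw] <-]|[x y] [/= [v Fv <-] [w Gw <-]]].
    by split; [exists (slice 0 w)|exists (slice 1 w)].
  exists (unslice (fun i => if i is 0 then v else w)).
    by rewrite /= !slice_unslice.
  by rewrite !slice_unslice.
Qed.

(* What is needed of a Polish space to develop the theory of its analytic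
   sets: a Hausdorff second countable regular continuous image of a closed
   subset of the Baire space. *)
Definition souslin_base (T : topologicalType) (B : nat -> set T) :=
  [/\ forall n, open (B n),
      forall x U, nbhs x U -> exists n, B n x /\ closure (B n) `<=` U,
      hausdorff_space T & analytic [set: T]].

Section BorelAnalytic.
Variables (T : topologicalType) (B : nat -> set T).
Hypothesis TB : souslin_base B.

Lemma closed_analytic (C : set T) : closed C -> analytic C.
Proof.
move=> clC; have [_ _ _ [F [f [cF cf fT]]]] := TB.
exists [set w | F w /\ C (f w)], f; split.
- move=> w wF.
  have Fw : F w by apply: cF => n; have [v [Fv _] ?] := wF n; exists v.
  split=> //; apply: contrapT => nC.
  have [n nP] := cf w (~` C) Fw (open_nbhs_nbhs (conj (closed_openC clC) nC)).
  by have [v [Fv Cv] vw] := wF n; have := nP v Fv vw.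
- by move=> w U [Fw _] /(cf _ _ Fw)[n nU]; exists n => v [Fv _]; exact: nU.
- apply/seteqP; split=> [x [w [_ ?] <-] //|x Cx].
  have : [set: T] x by []. rewrite -fT => -[w Fw wx].
  by exists w => //; rewrite /= wx.
Qed.

(** By regularity, U is the union of the closures of base sets that it contains. *)
Lemma open_analytic (U : set T) : open U -> analytic U.
Proof.
move=> oU; have [_ TB2 _ _] := TB.
rewrite (_ : U = \bigcup_n
    (if `[< closure (B n) `<=` U >] then closure (B n) else set0)).
  apply: analytic_bigcup => n; apply: closed_analytic.
  by case: ifP => _; [exact: closed_closure|exact: closed0].
apply/seteqP; split=> [x Ux|x [n _]]; last by case: asboolP => // + ?; exact.
have [n [Bx BU]] := TB2 x U (open_nbhs_nbhs (conj oU Ux)).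
by exists n => //; rewrite asboolT //; exact: subset_closure.
Qed.

(** The analytic sets with analytic complement form a sigma-algebra containing the open sets. *)
Lemma borel_analytic (A : set T) : borel A -> analytic A.
Proof.
have [_ _ hT _] := TB.
move=> bA.
suff [] : [set C : set T | analytic C /\ analytic (~` C)] A by [].
move: A bA; apply: smallest_sub; last first.
  by move=> U oU; split; [exact: open_analytic|
    apply: closed_analytic; exact: open_closedC].
split=> /=.
- by rewrite setC0; split; [exact/closed_analytic/closed0|
    exact/closed_analytic/closedT].
- by move=> C [C1 C2]; rewrite setTD setCK.
- move=> C CP; split; first by apply: analytic_bigcup => i; have [] := CP i.
  by rewrite setC_bigcup; apply: analytic_bigcap => // i; have [] := CP i.
Qed.

End BorelAnalytic.

(** * Separation of analytic sets by Borel sets *)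

Section Novikov.
Variable T : topologicalType.
Implicit Types S : nat -> set T.

Definition borel_separated S := exists B : nat -> set T,
  [/\ forall n, borel (B n), forall n, S n `<=` B n &
      forall x, exists n, ~ B n x].

(** From separating families [B k], take the union over k in position m and the intersection over k
    in the other positions. *)
Lemma borel_separated_split S m (S' : nat -> set T) :
  S m `<=` \bigcup_k S' k ->
  (forall k, borel_separated (fun n => if n == m then S' k else S n)) ->
  borel_separated S.
Proof.
move=> SmS' /choice[B BP].
exists (fun n => if n == m then \bigcup_k B k n else \bigcap_k B k n); split.
- move=> n; case: eqP => _; [apply: borel_bigcup|apply: borel_bigcap] => k;
  by have [] := BP k.
- move=> n x Snx; case: eqP => [nm|/eqP/negbTE nm].
    subst n; have [k _ S'k] := SmS' _ Snx; exists k => //.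
    by have [_ /(_ m) + _] := BP k; rewrite eqxx; exact.
  by move=> k _; have [_ /(_ n) + _] := BP k; rewrite nm; exact.
- move=> x; apply: contrapT => /forallNP Bx.
  have := Bx m; rewrite eqxx => /contrapT[k _ Bkm].
  have [_ _ /(_ x)[n]] := BP k; apply.
  have := Bx n; case: eqP => [-> //|_ /contrapT]; exact.
Qed.

Lemma dependent_nat_choice (P : seq nat -> Prop) :
  P [::] -> (forall s, P s -> exists k, P (rcons s k)) ->
  exists w : nat -> nat, forall n, P (mkseq w n).
Proof.
move=> P0 PS.
have /choice[next nextP] : forall s, exists k, P s -> P (rcons s k).
  move=> s.
  by have [/PS[k Pk]|nP] := pselect (P s); [exists k|exists 0].
pose pre := fix pre n :=
  if n is n'.+1 then rcons (pre n') (next (pre n')) else [::].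
exists (fun n => next (pre n)) => n.
suff -> : mkseq (fun n => next (pre n)) n = pre n.
  by elim: n => //= n IH; exact: nextP.
by elim: n => //= n IH; rewrite mkseqS IH.
Qed.

(* Otherwise one could find points [w n] of the parametrizing closed sets, all
   of them coded in a single sequence [w] built one entry at a time, such that
   the images of the neighbourhoods of the [w n] are not separated; the
   images of the [w n] must then coincide, as T is Hausdorff. *)
Lemma novikov_separation (A : nat -> set T) : hausdorff_space T ->
  (forall n, analytic (A n)) -> (forall x, exists n, ~ A n x) ->
  borel_separated A.
Proof.
move=> hT /choice[F] /choice[f] Ff A0; apply: contrapT => nsepA.
(* The image of those parameters of [A n] that are compatible with the finite code s. *)
pose S (s : seq nat) n := f n @` [set v | F n v /\
  forall i, pickle (n, i) < size s -> v i = nth 0 s (pickle (n, i))].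
have [||w wP] := @dependent_nat_choice (fun s => ~ borel_separated (S s)).
- apply: contra_not nsepA => -[B [bB SB B0]]; exists B; split=> // n x Ax.
  apply: SB; have [_ _ fA] := Ff n; move: Ax; rewrite -fA => -[v Fv <-].
  by exists v.
- move=> s nsep; apply: contrapT => /forallNP /(_ _)/contrapT sep.
  apply: nsep.
  (* The new entry has position [size s]. If this position codes (m, i), the entry fixes entry i of
     the m-th point and splits [S s m]; otherwise no point reads it and any value will do. *)
  have [[[m i] mi]|nmi] := pselect (exists p : nat * nat, pickle p = size s).
    apply: (@borel_separated_split _ m (fun k => S (rcons s k) m)).
      move=> x [v [Fv vs] <-]; exists (v i) => //; exists v => //; split=> // j.
      rewrite size_rcons ltnS nth_rcons leq_eqVlt.
      case: ltnP => [/vs //|_]; rewrite orbF => mj; rewrite mj.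
      by move: mj; rewrite -mi => /eqP/(pcan_inj pickleK)[->].
    move=> k; have [B [bB SB B0]] := sep k; exists B; split=> // n x.
    case: eqP => [->|nm]; first exact: SB.
    move=> [v [Fv vs] <-]; apply: SB; exists v => //; split=> // j.
    rewrite size_rcons ltnS nth_rcons leq_eqVlt.
    case: ltnP => [/vs //|_]; rewrite orbF -mi.
    by move=> /eqP/(pcan_inj pickleK)[/nm].
  have [B [bB SB B0]] := sep 0; exists B; split=> // n x [v [Fv vs] <-].
  apply: SB; exists v => //; split=> // j.
  rewrite size_rcons ltnS nth_rcons leq_eqVlt.
  case: ltnP => [/vs //|_]; rewrite orbF => /eqP e.
  by case: nmi; exists (n, j).
have SP m n v : S (mkseq w m) n v -> exists2 u, F n u /\
    (forall i, pickle (n, i) < m -> u i = slice n w i) & f n u = v.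
  move=> [u [Fu us] <-]; exists u => //; split=> // i im.
  by rewrite us ?size_mkseq // nth_mkseq.
have bound (n l : nat) : exists m, forall i, i < l -> pickle (n, i) < m.
  exists (\max_(j < l) pickle (n, val j)).+1 => i il.
  by rewrite ltnS; exact: (leq_bigmax (Ordinal il)).
have Fw n : F n (slice n w).
  have [cF _ _] := Ff n; apply: cF => l; have [m ml] := bound n l.
  apply: contrapT => nv; apply: (wP m).
  (* Otherwise the n-th image for this prefix is empty, so the empty set and the whole space
     separate. *)
  exists (fun k => if k == n then set0 else setT); split.
  - by move=> k; case: eqP => _; [exact: borel0|exact: borelT].
  - move=> k x; case: eqP => // -> /SP[u [Fu uw] _]; apply: nv.
    by exists u => // i /ml/uw.
  - by move=> x; exists n; rewrite eqxx.
have fw n : f n (slice n w) = f 0 (slice 0 w).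
  apply: contrapT => /(hausdorff_open hT)[U [V [oU oV Uf Vf UV]]].
  have [_ cn _] := Ff n; have [_ c0 _] := Ff 0.
  have [l lU] := cn _ _ (Fw n) (open_nbhs_nbhs (conj oU Uf)).
  have [l' lV] := c0 _ _ (Fw 0) (open_nbhs_nbhs (conj oV Vf)).
  have [m ml] := bound n l; have [m' ml'] := bound 0 l'.
  have n0 : 0 <> n by move=> n0; subst n; exact: (UV _ Uf).
  apply: (wP (maxn m m')).
  (* By continuity the disjoint sets U and V contain the n-th and the 0-th image for a long
     prefix. *)
  exists (fun k => if k == n then U else if k == 0 then V else setT); split.
  - move=> k; case: eqP => _; first exact: borel_open.
    by case: eqP => _; [exact: borel_open|exact: borelT].
  - move=> k x; case: eqP => [->|_].
      move=> /SP[u [Fu uw] <-]; apply: lU => // i il; apply: uw.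
      by rewrite leq_max ml.
    case: eqP => [->|//] /SP[u [Fu uw] <-]; apply: lV => // i il; apply: uw.
    by rewrite leq_max ml' ?orbT.
  - move=> x; have [Ux|nU] := pselect (U x); last by exists n; rewrite eqxx.
    by exists 0; move: n0 => /eqP/negbTE ->; rewrite eqxx; exact: UV.
have [n []] := A0 (f 0 (slice 0 w)).
by have [_ _ <-] := Ff n; exists (slice n w).
Qed.

(** Novikov's theorem for the sequence A, C, C, ...: a point of C lies in every [B n] with n
    positive, hence not in [B 0]. *)
Lemma analytic_separation (A C : set T) : hausdorff_space T ->
  analytic A -> analytic C -> (forall x, A x -> ~ C x) ->
  exists E : set T, [/\ borel E, A `<=` E & forall x, C x -> ~ E x].
Proof.
move=> hT aA aC AC.
have [||B [bB AB B0]] :=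
  @novikov_separation (fun n => if n is 0 then A else C) hT.
- by case.
- move=> x; have [/AC nC|nA] := pselect (A x); [by exists 1|by exists 0].
exists (B 0); split=> //; first exact: (AB 0).
move=> x Cx B0x; have [[|n] []] := B0 x => //.
exact: (AB n.+1).
Qed.

End Novikov.

Lemma analyticI (T : topologicalType) (A B : set T) : hausdorff_space T ->
  analytic A -> analytic B -> analytic (A `&` B).
Proof.
move=> hT aA aB.
rewrite (_ : A `&` B = \bigcap_n (if n is 0 then A else B)).
  by apply: analytic_bigcap => // -[].
apply/seteqP; split=> [x [Ax Bx] [|n] //|x AB].
by split; [exact: (AB 0)|exact: (AB 1)].
Qed.

Lemma analyticU (T : topologicalType) (A B : set T) :
  analytic A -> analytic B -> analytic (A `|` B).
Proof.
move=> aA aB.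
rewrite (_ : A `|` B = \bigcup_n (if n is 0 then A else B)).
  by apply: analytic_bigcup => -[].
apply/seteqP; split=> [x [Ax|Bx]|x [[|n] _ ABx]]; [by exists 0|by exists 1|..].
  by left.
by right.
Qed.

(** * Polish spaces: coding points by dense sequences, and Borel functions *)

Section Polish.
Import Order.TTheory GRing.Theory Num.Theory.
Local Open Scope ring_scope.
Variables (R : realType) (X : topologicalType) (d : X -> X -> R) (q : nat -> X).
Hypothesis dm : is_metric d.
Hypothesis dX : metrizes d.
Hypothesis dc : complete_metric d.
Hypothesis qd : forall x e, 0 < e -> exists i, d (q i) x < e.

Let rad n : R := n.+1%:R^-1.

Let rad_gt0 n : 0 < rad n.
Proof. by rewrite invr_gt0. Qed.

Let small_rad e : 0 < e -> exists n, rad n + rad n < e.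
Proof.
move=> e0; have e2 : 0 < e / 2 by rewrite divr_gt0.
have [n] := ltr_add_invr e2; rewrite add0r -/(rad n) => ne; exists n.
by rewrite [e]splitr ltrD.
Qed.

Let d_ge0 x y : 0 <= d x y. Proof. by have [] := dm. Qed.
Let d0 x y : d x y = 0 -> x = y.
Proof. by have [_ /(_ x y)[dxy _] _ _] := dm. Qed.
Let dC x y : d x y = d y x. Proof. by have [] := dm. Qed.
Let dT x y z : d x z <= d x y + d y z. Proof. by have [] := dm. Qed.

Let near_eq x y : (forall n, d x y <= rad n + rad n) -> x = y.
Proof.
move=> xy; apply: d0; apply/eqP; rewrite eq_le d_ge0 andbT leNgt.
apply/negP => /small_rad[n]; apply/negP; rewrite -leNgt; exact: xy.
Qed.

Let nbhs_dist x (U : set X) :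
  nbhs x U <-> exists2 e, 0 < e & forall y, d x y < e -> U y.
Proof. by rewrite dX; split=> -[e e0 eU]; exists e. Qed.

Let ball_open x e : open [set y | d x y < e].
Proof.
rewrite openE => y /= dy; apply/nbhs_dist; exists (e - d x y).
  by rewrite subr_gt0.
by move=> z dz /=; have := dT x y z; lra.
Qed.

(** Such an s codes a point: the centers form a Cauchy sequence, and passing to the limit removes
    the second radius. *)
Let code_limit (s : nat -> nat) :
  (forall n m, d (q (s n)) (q (s m)) < rad n + rad m) ->
  exists y, forall n, d (q (s n)) y <= rad n.
Proof.
move=> s_cauchy; have [|y sy] := dc (u := q \o s).
  move=> e /small_rad[n ne]; exists n => i j ni nj.
  apply: lt_trans (s_cauchy _ _) _; apply: le_lt_trans ne.
  by apply: lerD; rewrite lef_pV2 ?posrE ?ltr0n // ler_nat ltnS.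
exists y => n; rewrite leNgt; apply/negP => ny.
have e0 : 0 < d (q (s n)) y - rad n by rewrite subr_gt0.
have [k ke] := small_rad e0.
have /sy[N _ Ns] : nbhs y [set z | d y z < rad k].
  by apply/nbhs_dist; exists (rad k).
have /= := Ns (maxn N k) (leq_maxl _ _).
have := s_cauchy n (maxn N k); have := dT (q (s n)) (q (s (maxn N k))) y.
have : rad (maxn N k) <= rad k.
  by rewrite lef_pV2 ?posrE ?ltr0n // ler_nat ltnS leq_maxr.
by rewrite (dC y); lra.
Qed.

Let base (m : nat) : set X :=
  if unpickle m is Some (i, n) then [set y | d (q i) y < rad n] else set0.

Let polish_hausdorff : hausdorff_space X.
Proof.
move=> x y xy; apply: near_eq => n.
have [||z [/=]] := xy [set z | d x z < rad n] [set z | d y z < rad n].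
- by apply/nbhs_dist; exists (rad n).
- by apply/nbhs_dist; exists (rad n).
- by have := dT x z y; rewrite (dC z y); lra.
Qed.

Lemma polish_souslin_base : souslin_base base.
Proof.
split=> //.
- move=> m; rewrite /base; case: (unpickle m) => [[i n]|]; last exact: open0.
  exact: ball_open.
- move=> x U /nbhs_dist[e /small_rad[n ne] eU]; have [i ix] := qd x (rad_gt0 n).
  exists (pickle (i, n)); rewrite /base pickleK; split=> // y yc.
  apply: eU; apply: le_lt_trans ne; apply: le_trans (dT _ (q i) _) _.
  apply: lerD; first by rewrite dC ltW.
  rewrite leNgt; apply/negP => ny.
  have /yc[z [/= qz yz]] : nbhs y [set z | d y z < d (q i) y - rad n].
    by apply/nbhs_dist; exists (d (q i) y - rad n) => //; rewrite subr_gt0.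
  by have := dT (q i) z y; rewrite (dC z y); lra.
(* Each inequality involves only two entries of w, so the set of codes is closed. *)
pose F := [set w : nat -> nat |
  forall n m, d (q (w n)) (q (w m)) < rad n + rad m].
pose f w := xget (q 0) [set y | forall n, d (q (w n)) y <= rad n].
have fP w n : F w -> d (q (w n)) (f w) <= rad n.
  by move=> /code_limit Fw; have := xgetPex (q 0) Fw; exact.
exists F, f; split.
- move=> w wF n m; have [v Fv vw] := wF (maxn n m).+1.
  have <- : v n = w n by apply: vw; rewrite ltnS leq_maxl.
  have <- : v m = w m by apply: vw; rewrite ltnS leq_maxr.
  exact: Fv.
- move=> w U Fw /nbhs_dist[e /small_rad[n ne] eU]; exists n.+1 => v Fv vw.
  apply: eU; apply: le_lt_trans ne; apply: le_trans (dT _ (q (w n)) _) _.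
  by apply: lerD; [rewrite dC fP|rewrite -vw ?fP].
- apply/seteqP; split=> // x _.
  have /choice[w wx] : forall n, exists i, d (q i) x < rad n by move=> n;
    exact: qd.
  have Fw : F w.
    move=> n m; have := dT (q (w n)) x (q (w m)); rewrite (dC x).
    by have := wx n; have := wx m; lra.
  exists w => //; apply: near_eq => n.
  have := dT (f w) (q (w n)) x; rewrite (dC (f w) (q _)).
  by have := wx n; have := fP w n Fw; lra.
Qed.

(* A Borel set E i n separates the points whose value is in the ball of
   radius 1/(n+1) around q i from the other points of the domain; the values
   are recovered as limits of the centers of these balls. *)
Lemma borel_uniformization (C : set (X * X)) :
  hausdorff_space (X * X)%type -> analytic C ->
  (forall x y z, C (x, y) -> C (x, z) -> y = z) ->
  exists g : X -> X, borel_fun g /\ forall x y, C (x, y) -> y = g x.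
Proof.
move=> hXX aC C1.
have aA (V : set X) : borel V -> analytic (fst @` (C `&` (setT `*` V))).
  move=> bV; apply: analytic_image; first by move=> ?; exact: cvg_fst.
  apply: analyticI => //; apply: analyticX.
    by apply: (borel_analytic polish_souslin_base); exact: borelT.
  exact: (borel_analytic polish_souslin_base).
have bB i n : borel [set y | d (q i) y < rad n] by exact: borel_open.
have /choice[E EP] : forall p : nat * nat, exists E : set X,
    borel E /\ forall x y, C (x, y) -> E x <-> d (q p.1) y < rad p.2.
  move=> [i n] /=.
  have [|E [bE AE A'E]] := analytic_separation polish_hausdorff (aA _ (bB i n))
      (aA _ (borelC (bB i n))).
    move=> _ [[x y] [/= Cxy [_ /= dy]] <-] [[x' z] [/= Cxz [_ /= nz]] /= xx'].
    by subst x'; move: dy; rewrite (C1 _ _ _ Cxy Cxz).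
  exists E; split=> // x y Cxy; split=> [Ex|dy].
    by apply: contrapT => dy; apply: A'E Ex; exists (x, y).
  by apply: AE; exists (x, y).
(* Z consists of the x at which the sets E describe a point of X; it may exceed the domain of C. Off
   Z, g is the identity by default. *)
pose Z := [set x | (forall n, exists i, E (i, n) x) /\
  forall p p', E p x -> E p' x -> d (q p.1) (q p'.1) < rad p.2 + rad p'.2].
have bE p : borel (E p) by have [] := EP p.
have bZ : borel Z.
  apply: borelI.
    by apply: borel_forall => n; apply: borel_exists.
  apply: borel_forall => p; apply: borel_forall => p'.
  apply: borel_imply => //; apply: borel_imply => //; exact: borel_cst.
pose g x := xget x [set y | Z x /\ forall p, E p x -> d (q p.1) y <= rad p.2].
have gZ x : Z x -> forall p, E p x -> d (q p.1) (g x) <= rad p.2.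
  move=> Zx; suff /(xgetPex x)[] : exists y, Z x /\
      forall p, E p x -> d (q p.1) y <= rad p.2 by [].
  have [/choice[s sE] Exx] := Zx.
  have [|y sy] := code_limit (s := s); first by move=> n m;
    exact: (Exx (_, _) (_, _)).
  exists y; split=> // p Ep; rewrite leNgt; apply/negP; rewrite -subr_gt0.
  move=> /small_rad[m]; have := Exx _ _ Ep (sE m); have := sy m => /=.
  by have := dT (q p.1) (q (s m)) y; lra.
have gNZ x : ~ Z x -> g x = x by move=> nZ; apply: xgetPN => y [].
exists g; split=> [A oA|x y Cxy].
  (* On Z, the value lies in the open set A exactly when x belongs to some [E p] whose closed ball
     is contained in A. *)
  rewrite (_ : g @^-1` A =
    (Z `&` [set x | exists p, (forall y,
      d (q p.1) y <= rad p.2 -> A y) /\ E p x])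
    `|` (~` Z `&` A)).
    apply: borelU; last by apply: borelI; [exact: borelC|exact: borel_open].
    apply: borelI => //; apply: borel_exists => p; apply: borelI => //.
    exact: borel_cst.
  apply/seteqP; split=> x /=.
    have [Zx|nZ] := pselect (Z x); last by rewrite gNZ //; right.
    move=> Ag; left; split=> //.
    have [e /small_rad[n ne] eA] :
      exists2 e, 0 < e & forall y, d (g x) y < e -> A y.
      by apply/nbhs_dist/open_nbhs_nbhs.
    have [/(_ n)[i Ei] _] := Zx; exists (i, n); split=> //= y qy.
    apply: eA; have := dT (g x) (q i) y; have := gZ x Zx _ Ei => /=.
    by rewrite (dC (g x) (q i)); lra.
  move=> [[Zx [p [pA Ep]]]|[nZ Ax]]; last by rewrite gNZ.
  by apply: pA; exact: gZ.
have Exy p : E p x <-> d (q p.1) y < rad p.2 by have [_] := EP p; exact.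
have Zx : Z x.
  split=> [n|p p' /Exy + /Exy].
    by have [i iy] := qd y (rad_gt0 n); exists i; apply/Exy.
  by have := dT (q p.1) y (q p'.1); rewrite (dC y); lra.
apply: near_eq => n; have [i iy] := qd y (rad_gt0 n).
have /(gZ x Zx) /= : E (i, n) x by apply/Exy.
by have := dT y (q i) (g x); rewrite (dC y (q i)); lra.
Qed.

End Polish.

(** * Products, and Borel sets of pairs *)

Section Product.
Variables (X : topologicalType) (B : nat -> set X).
Hypothesis XB : souslin_base B.

Let rect (m : nat) : set (X * X) :=
  if unpickle m is Some (i, j) then B i `*` B j else set0.

Let open_rect (i j : nat) : open (B i `*` B j).
Proof.
have [oB _ _ _] := XB; rewrite openE => -[x y] [/= Bx By].
by exists (B i, B j) => //=; split=> /=; apply: open_nbhs_nbhs.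
Qed.

Lemma product_souslin_base : souslin_base rect.
Proof.
have [oB nB hX aX] := XB; split.
- move=> m; rewrite /rect; case: (unpickle m) => [[i j]|]; last exact: open0.
  exact: open_rect.
- move=> [x y] U [[V W] /= [/nB[i [Bx BV]] /nB[j [By BW]]] VWU].
  exists (pickle (i, j)); rewrite /rect pickleK; split=> // -[a b] ab.
  apply: VWU; split=> /=.
    apply: BV => A Aa; have [|[z t] [[/= Bz _] [/= Az _]]] := ab (A `*` setT).
      by exists (A, setT) => //; split => //; exact: filterT.
    by exists z.
  apply: BW => A Aa; have [|[z t] [[/= _ Bt] [/= _ At]]] := ab (setT `*` A).
    by exists (setT, A) => //; split => //; exact: filterT.
  by exists t.
- move=> [x y] [x' y'] xy; congr pair; apply: hX => V W Vx Wx.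
    have [||[z t] [[/= Vz _] [/= Wz _]]] := xy (V `*` setT) (W `*` setT).
    + by exists (V, setT) => //; split => //; exact: filterT.
    + by exists (W, setT) => //; split => //; exact: filterT.
    by exists z.
  have [||[z t] [[/= _ Vt] [/= _ Wt]]] := xy (setT `*` V) (setT `*` W).
  + by exists (setT, V) => //; split => //; exact: filterT.
  + by exists (setT, W) => //; split => //; exact: filterT.
  by exists t.
- by rewrite -setXTT; exact: analyticX.
Qed.

(** An open subset of the product is a countable union of base rectangles. *)
Lemma borel_pair (S : topologicalType) (f g : S -> X) :
  borel_fun f -> borel_fun g -> borel_fun (fun x => (f x, g x)).
Proof.
have [oB nB _ _] := XB; move=> bf bg A oA.
rewrite (_ : _ @^-1` A = [set x | exists i j, B i `*` B j `<=` A /\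
    (f @^-1` B i `&` g @^-1` B j) x]).
  apply: borel_exists => i; apply: borel_exists => j.
  by apply: borelI; [exact: borel_cst|apply: borelI; [exact: bf|exact: bg]].
apply/seteqP; split=> [x /= Ax|x [i [j [BA [Bi Bj]]]]]; last exact: BA.
have [[V W] /= [/nB[i [Bx BV]] /nB[j [By BW]]] VWA] :
  nbhs (f x, g x) A by exact: open_nbhs_nbhs.
exists i, j; split=> // -[a b] [/= Ba Bb]; apply: VWA; split=> /=.
  by apply: BV; exact: subset_closure.
by apply: BW; exact: subset_closure.
Qed.

Lemma borel_fst (A : set X) : borel A -> borel (A `*` [set: X]).
Proof.
move=> bA; rewrite setXT.
by apply: borel_preimage => //; apply: continuous_borel => ?; exact: cvg_fst.
Qed.

Lemma borel_snd (A : set X) : borel A -> borel ([set: X] `*` A).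
Proof.
move=> bA; rewrite setTX.
by apply: borel_preimage => //; apply: continuous_borel => ?; exact: cvg_snd.
Qed.

Lemma borel_prod (A U : set X) : borel A -> borel U -> borel (A `*` U).
Proof.
move=> bA bU; rewrite (_ : A `*` U = A `*` setT `&` setT `*` U).
  by apply: borelI; [exact: borel_fst|exact: borel_snd].
by apply/seteqP; split=> -[x y] => [[]|[[? _] [_ ?]]].
Qed.

(** Finite sets are closed in a Hausdorff space. This lets a base index name one vertex among
    finitely many. *)
Lemma base_isolate (x : X) (A : set X) : finite_set A ->
  exists i, B i x /\ forall y, A y -> B i y -> y = x.
Proof.
have [_ nB hX _] := XB; move=> fA.
have clA : closed (A `\ x).
  have /accessible_finite_set_closed := hausdorff_accessible hX; apply.
  exact: finite_setD.
have [|i [Bx BA]] := nB x (~` (A `\ x)).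
  by apply: open_nbhs_nbhs; split; [exact: closed_openC|move=> [_]; exact].
exists i; split=> // y Ay By; apply: contrapT => yx.
exact: (BA _ (subset_closure By)).
Qed.

Lemma borel_neq (S : topologicalType) (f g : S -> X) :
  borel_fun f -> borel_fun g -> borel [set x | f x <> g x].
Proof.
have [oB nB hX _] := XB; move=> bf bg.
rewrite (_ : mkset _ = [set x | exists i, (f @^-1` B i `\` g @^-1` B i) x]).
  by apply: borel_exists => i; apply: borelD; [exact: bf|exact: bg].
apply/seteqP; split=> [x /= fg|x [i [fi ngi]] /= fg]; last by apply: ngi;
  rewrite /preimage /= -fg.
have [i [Bi iU]] := base_isolate (f x) (finite_set1 (g x)).
by exists i; split=> // /(iU _ erefl)/esym.
Qed.

End Product.

(** * Covering a locally finite Borel graph by graphs of Borel functions *)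

Section Enumeration.
Variables (R : realType) (X : topologicalType).

Lemma polish_dense_seq (x0 : X) : polish_space R X ->
  exists (d : X -> X -> R) (q : nat -> X),
    [/\ is_metric d, metrizes d, complete_metric d &
        forall x (e : R), (0 < e)%R -> exists i, (d (q i) x < e)%R].
Proof.
move=> [[D [cD dD]] [d [dm dX dc]]].
have /countable_injP[h hD] := cD.
pose q n := xget x0 [set x | D x /\ h x = n].
have qD x : D x -> q (h x) = x.
  move=> Dx; have : exists y, D y /\ h y = h x by exists x.
  by move=> /(xgetPex x0)[Dq hq]; apply: hD => //; rewrite inE.
have dC x y : d x y = d y x by have [] := dm.
exists d, q; split=> // x e e0.
have : nbhs x [set y | (d x y < e)%R] by rewrite dX; exists e.
rewrite nbhsE => -[V [oV Vx] Ve]; have [|y [Vy Dy]] := dD V _ oV.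
  by exists x.
by exists (h y); rewrite qD // dC; exact: Ve.
Qed.

Lemma polish_base (x0 : X) : polish_space R X ->
  exists B : nat -> set X, souslin_base B.
Proof.
move=> /(polish_dense_seq x0)[d [q [dm dX dc qd]]].
by eexists; exact: polish_souslin_base dm dX dc qd.
Qed.

(* By Novikov separation, G is covered by the countably many Borel sets of
   edges (x, y) contained in {(x, y) | y is the only neighbor of x in B k}. *)
Lemma borel_enumeration (x0 : X) (G : set (X * X)) : polish_space R X ->
  borel G -> locally_finite G ->
  exists g : nat -> X -> X, [/\ forall n, borel_fun (g n),
    forall n x, g n x = x \/ G (x, g n x) &
    forall x y, G (x, y) -> exists n, y = g n x].
Proof.
move=> /(polish_dense_seq x0)[d [q [dm dX dc qd]]] bG lfG.
have [B XB] : exists B : nat -> set X, souslin_base B.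
  by eexists; exact: polish_souslin_base dm dX dc qd.
have [oB nB hX aX] := XB; have XXB := product_souslin_base XB.
have [_ _ hXX _] := XXB.
have aXX := borel_analytic XXB.
have bB i : borel (B i) by exact: borel_open.
(* The points with a neighbor in both [B k] and [B m]. *)
pose P k m := fst @` (G `&` (setT `*` (B k `&` B m))).
have aP k m : analytic (P k m).
  apply: analytic_image; first by move=> ?; exact: cvg_fst.
  by apply: aXX; apply: borelI => //; apply: borel_snd; exact: borelI.
(* The bad edges (x, y) for k: either y is not in [B k], or some [B m] missing y contains a neighbor
   of x in [B k]. Isolating y among the neighbors of x shows that no edge is bad for all k. *)
pose A k := (G `&` (setT `*` ~` B k)) `|`
  \bigcup_m ((G `&` (setT `*` ~` B m)) `&` (P k m `*` setT)).
have aA k : analytic (A k).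
  apply: analyticU.
    by apply: aXX; apply: borelI => //; apply: borel_snd; exact: borelC.
  apply: analytic_bigcup => m; apply: analyticI => //; last exact: analyticX.
  by apply: aXX; apply: borelI => //; apply: borel_snd; exact: borelC.
have [|C [bC AC C0]] := novikov_separation hXX aA.
  move=> [x y]; have [Gxy|nG] := pselect (G (x, y)); last first.
    by exists 0 => -[[]|[m _ [[]]]].
  have [k [Bky kU]] := base_isolate XB y (lfG x).
  exists k => -[[_ [_]]|[m _ [[_ [_ /= nBm]] [/= [[x' y'] [Gxy' [_ [Bk Bm]]] /=
    xx'] _]]]] //.
  by subst x'; apply: nBm; rewrite -(kU y').
(* As [C k] contains the bad edges, what is left of G outside it is the graph of a partial
   function. *)
have /choice[g gP] : forall k, exists g : X -> X, borel_fun g /\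
    forall x y, (G `\` C k) (x, y) -> y = g x.
  move=> k; apply: (borel_uniformization dm dX dc qd hXX).
    by apply: aXX; exact: borelD.
  move=> x y z [Gxy nCy] [Gxz nCz]; apply: contrapT => yz.
  have nA (u : X) : ~ C k (x, u) -> ~ A k (x, u) by move=> nC /AC.
  have Bz : B k z.
    by apply: contrapT => nBz; apply: (nA z nCz); left.
  have [m [Bm mU]] := base_isolate XB z (finite_set1 y).
  apply: (nA y nCy); right; exists m => //; split; last first.
    by split=> //; exists (x, z).
  by split=> //; split=> // /= /(mU _ erefl).
pose Dk k := (fun x => (x, g k x)) @^-1` (G `\` C k).
have bg k : borel_fun (g k) by have [] := gP k.
have bDk k : borel (Dk k).
  apply: borel_preimage; last exact: borelD.
  by apply: (borel_pair XB) => // V /borel_open.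
(* The default value x replaces values of [g k] that do not come from an edge outside [C k]. *)
exists (fun k x => if `[< Dk k x >] then g k x else x); split.
- move=> k V oV.
  rewrite (_ : _ @^-1` V = (Dk k `&` g k @^-1` V) `|` (V `\` Dk k)).
    apply: borelU; first by apply: borelI => //; exact: bg.
    by apply: borelD => //; exact: borel_open.
  apply/seteqP; split=> [x /=|x [[Dx Vg]|[Vx nDx]] /=].
  + by case: asboolP => ? ?; [left|right].
  + by rewrite asboolT.
  + by rewrite asboolF.
- by move=> k x; case: asboolP => [[]|]; [right|left].
- move=> x y Gxy; have [k nC] := C0 (x, y); exists k.
  have [_ gk] := gP k; have yg : y = g k x by exact: gk.
  by rewrite asboolT // /Dk /= -yg.
Qed.

End Enumeration.

(** * König's edge coloring theorem *)

Section Konig.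
Variables L R : eqType.
Implicit Types (E : seq (L * R)) (c : L * R -> nat).

Definition proper_on E c :=
  forall e f, e \in E -> f \in E -> e.1 = f.1 \/ e.2 = f.2 ->
    c e = c f -> e = f.

(* The vertices of the Kempe chain alternating between [b] and [a] that
   starts at the left vertex [u0] with an edge coloured [b]. *)
Inductive kempe E c (a b : nat) (u0 : L) : L + R -> Prop :=
  | Kempe_start : kempe E c a b u0 (inl u0)
  | Kempe_right u v : kempe E c a b u0 (inl u) ->
      (u, v) \in E -> c (u, v) = b -> kempe E c a b u0 (inr v)
  | Kempe_left u v : kempe E c a b u0 (inr v) ->
      (u, v) \in E -> c (u, v) = a -> kempe E c a b u0 (inl u).

(** Testing the left endpoint suffices: by [kempe_edge], an edge colored a or b has both endpoints
    on the chain or neither, provided a is missing at [u0]. *)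
Definition kempe_swap E c (a b : nat) (u0 : L) (e : L * R) : nat :=
  if `[< kempe E c a b u0 (inl e.1) >] then
    if c e == a then b else if c e == b then a else c e
  else c e.

(** The chain enters right vertices by edges colored b and left vertices other than [u0] by edges
    colored a. By properness, the entering edge is the only one of its color there; at [u0] no edge
    has color a. *)
Lemma kempe_edge E c a b u0 e : proper_on E c ->
  (forall v, (u0, v) \in E -> c (u0, v) <> a) ->
  e \in E -> c e = a \/ c e = b ->
  kempe E c a b u0 (inl e.1) <-> kempe E c a b u0 (inr e.2).
Proof.
case: e => u v /= cP u0a Ee [] ce; split.
- move Ew: (inl u) => w kw; case: kw Ew => [[]|//|u' v' kv' E' c' [Eu]].
    by move=> Eu; subst u; case: (u0a _ Ee).
  subst u'.
  by have [->] := cP _ _ Ee E' (or_introl erefl) (etrans ce (esym c')).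
- by move=> kv; apply: Kempe_left kv Ee ce.
- by move=> ku; apply: Kempe_right ku Ee ce.
- move Ew: (inr v) => w kw; case: kw Ew => [//|u' v' kv' E' c' [Ev]|//].
  subst v'.
  by have [->] := cP _ _ Ee E' (or_intror erefl) (etrans ce (esym c')).
Qed.

Lemma kempe_swap_proper E c a b u0 : proper_on E c ->
  (forall v, (u0, v) \in E -> c (u0, v) <> a) ->
  proper_on E (kempe_swap E c a b u0).
Proof.
move=> cP u0a e f Ee Ef ef; rewrite /kempe_swap.
have eP := kempe_edge cP u0a Ee; have fP := kempe_edge cP u0a Ef.
case: ef => ef.
  rewrite ef => H; apply: cP => //; first by left.
  case: asboolP H => // _.
  by repeat case: eqP => ?; congruence.
have {}eP : c e = a \/ c e = b -> `[< kempe E c a b u0 (inl e.1) >] =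
    `[< kempe E c a b u0 (inr e.2) >] by move=> /eP H; apply: asbool_equiv_eq.
have {}fP : c f = a \/ c f = b -> `[< kempe E c a b u0 (inl f.1) >] =
    `[< kempe E c a b u0 (inr e.2) >].
  by rewrite ef => /fP H; apply: asbool_equiv_eq.
move=> H; apply: cP => //; first by right.
move: H eP fP.
case: `[< kempe _ _ _ _ _ (inl e.1) >]; case: `[< kempe _ _ _ _ _ (inl f.1) >];
  case: `[< kempe _ _ _ _ _ _ >];
  repeat case: eqP => ?; intros; first [congruence |
    by have := eP ltac:(first [left; congruence | right; congruence]) |
    by have := fP ltac:(first [left; congruence | right; congruence])].
Qed.

Lemma missing_color (d : nat) (s : seq nat) :
  size s < d -> exists2 a, a < d & a \notin s.
Proof.
move=> sd; case: (pselect (exists2 a, a < d & a \notin s)) => // nH.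
suff: d <= size s by rewrite leqNgt sd.
rewrite -[d](size_iota 0); apply: uniq_leq_size.
  exact: iota_uniq.
move=> a; rewrite mem_iota add0n => /andP[_ ad].
by apply/negPn/negP => na; apply: nH; exists a.
Qed.

(** Induction on the edges. With a missing at [u0] and b missing at [v0], the swap along the chain
    from [u0] makes b missing at [u0]. The chain enters right vertices by color b only, so it avoids
    [v0], and b becomes available for the new edge. *)
Lemma konig (d : nat) E : uniq E ->
  (forall u, count (fun e => e.1 == u) E <= d) ->
  (forall v, count (fun e => e.2 == v) E <= d) ->
  exists2 c, (forall e, e \in E -> c e < d) & proper_on E c.
Proof.
elim: E => [|[u0 v0] E IH] /=; first by exists (fun=> 0).
move=> /andP[E0 uE] dL dR.
have [||c cd cP] := IH uE.
- by move=> u; apply: leq_trans (dL u); rewrite leq_addl.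
- by move=> v; apply: leq_trans (dR v); rewrite leq_addl.
have [a ad na] : exists2 a, a < d & a \notin [seq c e | e <- E & e.1 == u0].
  apply: missing_color; rewrite size_map size_filter.
  by have := dL u0; rewrite eqxx.
have [b bd nb] : exists2 b, b < d & b \notin [seq c e | e <- E & e.2 == v0].
  apply: missing_color; rewrite size_map size_filter.
  by have := dR v0; rewrite eqxx.
have u0a e : e \in E -> e.1 = u0 -> c e <> a.
  move=> Ee eu ca; case/negP: na; apply/mapP; exists e => //.
  by rewrite mem_filter eu eqxx.
have v0b e : e \in E -> e.2 = v0 -> c e <> b.
  move=> Ee eu ca; case/negP: nb; apply/mapP; exists e => //.
  by rewrite mem_filter eu eqxx.
have u0a' v : (u0, v) \in E -> c (u0, v) <> a by move=> /u0a; apply.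
have swP := kempe_swap_proper (b := b) cP u0a'.
pose c' := kempe_swap E c a b u0.
have nv0 : ~ kempe E c a b u0 (inr v0).
  move Ew: (inr v0) => w kw; case: kw Ew => [//|u' v' _ E' ce [Ev]|//].
  by subst v'; apply: v0b E' _ ce.
have c'b e : e \in E -> e.1 = u0 \/ e.2 = v0 -> c' e <> b.
  move=> Ee [] ev; rewrite /c' /kempe_swap.
    rewrite asboolT; last by rewrite ev; exact: Kempe_start.
    have := u0a _ Ee ev; case: (c e =P a) => // nca _.
    by case: (c e =P b) => // ncb; congruence.
  have cb := v0b _ Ee ev.
  case: asboolP => // ku; case: (c e =P a) => [ca _|nca].
    by apply: nv0; rewrite -ev; apply/(kempe_edge cP u0a' Ee); [left|].
  by case: (c e =P b).
exists (fun e => if e == (u0, v0) then b else c' e).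
  move=> e; rewrite inE; case: eqP => //= _ Ee.
  by rewrite /c' /kempe_swap; case: asboolP; repeat case: eqP => ?; move=> *;
    rewrite ?cd.
move=> e f; rewrite !inE.
case: eqP => [->|ne]; case: eqP => [->|nf] //= Ee Ef ef.
- by move=> /esym cb; case: (c'b f Ef) => //; case: ef => /= <-; tauto.
- by move=> cb; case: (c'b e Ee) => //; case: ef => /= ->; tauto.
- exact: swP.
Qed.

End Konig.

(** * Finite bipartite components *)

Section OddCycles.
Variables (T : eqType) (e : rel T).

Lemma repeated_split (p : seq T) : ~~ uniq p ->
  exists x p1 p2 p3, p = p1 ++ x :: p2 ++ x :: p3.
Proof.
elim: p => //= x p IH; rewrite negb_and negbK => /orP[/splitPr[p2 p3]|/IH].
  by exists x, [::], p2, p3.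
by move=> [y [p1 [p2 [p3 ->]]]]; exists y, (x :: p1), p2, p3.
Qed.

(** A repeated vertex splits an odd closed walk into two shorter ones, one of which is odd. *)
Lemma odd_cycle_ucycle (p : seq T) : cycle e p -> odd (size p) ->
  exists q, ucycle e q /\ odd (size q).
Proof.
have [n] := ubnP (size p); elim: n p => // n IH p; rewrite ltnS => pn cp op.
have [up|/repeated_split[x [p1 [p2 [p3 pE]]]]] := boolP (uniq p).
  by exists p; rewrite /ucycle cp up.
have : cycle e (rot (size p1) p) by rewrite rot_cycle.
rewrite {1}pE rot_size_cat /= -catA rcons_cat cat_path /=.
move=> /and3P[p2P e2 p3P].
have c2 : cycle e (x :: p2) by rewrite /= rcons_path p2P.
have c3 : cycle e (x :: p3 ++ p1) by [].
have pS : size p = size (x :: p2) + size (x :: p3 ++ p1).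
  by rewrite pE /= !size_cat /= !size_cat /= !addnS !addSn addnC addnA.
move: op; rewrite pS oddD; case o2: (odd (size (x :: p2))) => o3.
  apply: IH c2 o2; apply: leq_trans pn; rewrite pS.
  by rewrite -[X in X < _]addn0 ltn_add2l.
apply: IH c3 o3; apply: leq_trans pn; rewrite pS.
by rewrite -[X in X < _]add0n ltn_add2r.
Qed.

Lemma even_closed_walk (x : T) (p : seq T) :
  (forall q, ucycle e q -> ~~ odd (size q)) ->
  path e x p -> last x p = x -> ~~ odd (size p).
Proof.
move=> eP; case/lastP: p => // p y xp; rewrite last_rcons => yx; subst y.
apply/negP => op; have [|q [/eP/negP uq oq]] := @odd_cycle_ucycle (x :: p) xp.
  by move: op; rewrite size_rcons.
exact: uq.
Qed.

End OddCycles.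

Section Graphs.
Variable X : choiceType.
Implicit Types (G H : set (X * X)) (x y : X).

Definition sym_graph G := forall x y, G (x, y) -> G (y, x).

(** Stated with duplicate-free lists so that bounds pass to subgraphs and follow from injective
    colorings by counting. *)
Definition degree_le G (k : nat) x :=
  forall s : seq X, uniq s -> (forall y, y \in s -> G (x, y)) -> size s <= k.

Lemma adjE G x y : adj G x y = `[< G (x, y) >].
Proof. by rewrite /adj; apply/idP/asboolP; rewrite in_setE. Qed.

Lemma adjP G x y : reflect (G (x, y)) (adj G x y).
Proof. by rewrite adjE; exact: asboolP. Qed.

Lemma path_sub G H x p : H `<=` G -> path (adj H) x p -> path (adj G) x p.
Proof. by move=> HG; apply: sub_path => a b /adjP/HG/adjP. Qed.

Lemma bipartite_sub G H : H `<=` G -> bipartite G -> bipartite H.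
Proof.
move=> HG bG p /andP[cp up]; apply: bG; rewrite /ucycle up andbT.
by case: p cp {up} => //= x p; exact: path_sub.
Qed.

Lemma component_sub G H x : H `<=` G -> component H x `<=` component G x.
Proof. by move=> HG y [p [xp <-]]; exists p; split => //;
  exact: path_sub xp. Qed.

Lemma component_finite_sub G H :
  H `<=` G -> component_finite G -> component_finite H.
Proof. by move=> HG cG x; apply: sub_finite_set (cG x);
  exact: component_sub. Qed.

Lemma component_refl G x : component G x x.
Proof. by exists [::]. Qed.

Lemma component_edge G x y z : component G x y -> G (y, z) -> component G x z.
Proof.
move=> [p [xp <-]] /adjP yz; exists (rcons p z).
by rewrite rcons_path xp last_rcons.
Qed.

Lemma component_edgel G x y z : G (x, y) -> component G y z -> component G x z.
Proof. by move=> /adjP xy [p [yp <-]]; exists (y :: p); rewrite /= xy. Qed.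

Lemma component_finite_locally G : component_finite G -> locally_finite G.
Proof.
move=> cG x; apply: sub_finite_set (cG x) => y.
exact/component_edge/component_refl.
Qed.

Lemma degree_le_sub G H k x : H `<=` G -> degree_le G k x -> degree_le H k x.
Proof. by move=> HG dG s us sH; apply: dG => // y /sH/HG. Qed.

Lemma bipartite_irrefl G x : bipartite G -> ~ G (x, x).
Proof.
move=> bG /adjP xx; have := bG [:: x].
by rewrite /ucycle /= xx; move=> /(_ isT).
Qed.

(** The side of y records whether an odd walk leads from x to y. Two odd walks to the ends of an
    edge would close up to an odd closed walk. *)
Lemma component_side G x : sym_graph G -> bipartite G ->
  exists side : X -> bool, forall u v, component G x u -> G (u, v) ->
    side u != side v.
Proof.
move=> sG bG.
pose odd_walk y p := [/\ path (adj G) x p, last x p = y & odd (size p)].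
exists (fun y => `[< exists p, odd_walk y p >]) => u v xu uv.
have [p [xp pu]] := xu.
have xv : path (adj G) x (rcons p v) by rewrite rcons_path xp pu; apply/adjP.
case: asboolP => [[pu' [xp' pu'E opu']]|nu]; last first.
  rewrite eq_sym asboolT //; exists (rcons p v); split; rewrite ?last_rcons //.
  rewrite size_rcons /=; apply/negP => op; apply: nu.
  by exists p.
rewrite asboolF // => -[q [xq qv oq]].
have := @even_closed_walk _ (adj G) x (pu' ++ v :: rev (belast x q)) bG.
rewrite cat_path xp' pu'E last_cat /=.
have -> : adj G u v by apply/adjP.
have -> : path (adj G) v (rev (belast x q)).
  rewrite -qv rev_path; apply: sub_path xq => a b /adjP/sG ba; exact/adjP.
have -> : last v (rev (belast x q)) = x.
  by case: (q) qv => [|y q'] //=; rewrite rev_cons last_rcons.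
by move=> /(_ isT erefl);
  rewrite size_cat /= size_rev size_belast oddD opu' /= oq.
Qed.

End Graphs.

(** * Borel colorings of graphs with finite components *)

Lemma first_index (T : Type) (P : nat -> T -> Prop) :
  (forall x, exists n, P n x) -> exists f : T -> nat, forall x,
    P (f x) x /\ forall m, m < f x -> ~ P m x.
Proof.
move=> Pex.
suff /choice[f fP] : forall x, exists n, P n x /\ forall m, m < n -> ~ P m x.
  by exists f.
move=> x; have ex : exists n, `[< P n x >].
  by have [n Pn] := Pex x; exists n; exact/asboolP.
exists (ex_minn ex); case: ex_minnP => n /asboolP Pn nmin; split=> // m mn Pm.
by have := nmin m; rewrite asboolT // leqNgt mn; move=> /(_ isT).
Qed.

Lemma first_index_eq (P Q : nat -> Prop) (n m : nat) :
  (forall i, P i <-> Q i) -> P n -> (forall i, i < n -> ~ P i) ->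
  Q m -> (forall i, i < m -> ~ Q i) -> n = m.
Proof.
move=> PQ Pn nP Qm mQ; case: (ltngtP n m) => // nm.
  by case: (mQ n nm); apply/PQ.
by case: (nP m nm); apply/PQ.
Qed.

Section BorelGraphs.
Variables (R : realType) (X : topologicalType) (x0 : X).
Hypothesis XP : polish_space R X.
Implicit Types (G H : set (X * X)) (A U : set X).

Let walk (g : nat -> X -> X) (w : seq nat) (x : X) : X :=
  foldl (fun y n => g n y) x w.

Let walk_borel g w : (forall n, borel_fun (g n)) -> borel_fun (walk g w).
Proof.
move=> bg; elim: w => [|n w IH]; first by move=> A /borel_open.
exact: (borel_fun_comp (bg n) IH).
Qed.

(** Quantifiers over a component become quantifiers over the countably many words w, which preserve
    Borel sets. *)
Let walk_component H g x y : (forall n x, g n x = x \/ H (x, g n x)) ->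
  (forall x y, H (x, y) -> exists n, y = g n x) ->
  component H x y <-> exists w, y = walk g w x.
Proof.
move=> gH Hg; split=> [[p [xp <-]]|[w ->]].
  elim: p x xp => [|z p IH] x /=; first by exists [::].
  move=> /andP[/adjP/Hg[n ->] /IH[w ->]]; by exists (n :: w).
elim: w x => [|n w IH] x; first exact: component_refl.
have [e|xn] := gH n x; first by rewrite /= e.
exact: component_edgel xn (IH _).
Qed.

Section Codes.
Variable B : nat -> set X.
Hypothesis XB : souslin_base B.

(* A finite list of entries (i, j, k), read as: the edges between B i and B j
   that are not treated by a previous entry get the color k. *)
Fixpoint code_color (p : seq (nat * nat * nat)) (e : X * X) : nat :=
  if p is (i, j, k) :: p' then
    if `[< (B i `*` B j `|` B j `*` B i) e >] then k else code_color p' e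
  else 0.

Lemma code_colorC p x y : code_color p (x, y) = code_color p (y, x).
Proof.
elim: p => [|[[i j] k] p IH] //=; rewrite IH.
congr (if _ then _ else _); apply: asbool_equiv_eq.
by split=> -[[/= ? ?]|[/= ? ?]]; [right|left|right|left].
Qed.

Lemma code_color_borel p k : borel [set e | code_color p e = k].
Proof.
have [oB _ _ _] := XB; have bB i : borel (B i) by exact: borel_open.
elim: p => [|[[i j] l] p IH] /=; first exact: borel_cst.
have bR : borel (B i `*` B j `|` B j `*` B i).
  by apply: borelU; exact: borel_prod.
move: bR; set Rij := (X in borel X) => bR.
rewrite (_ : mkset _ =
  (Rij `&` [set _ | l = k]) `|` ([set e | code_color p e = k] `\` Rij)).
  by apply: borelU; [apply: borelI => //; exact: borel_cst|exact: borelD].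
apply/seteqP; split=> [e /=|e [[Re /= lk]|[/= ek nRe]]].
- by case: asboolP => ? ?; [left|right].
- by rewrite asboolT.
- by rewrite asboolF.
Qed.

(** Base sets isolating x and y in C give an entry that, among pairs of points of C, affects only
    (x, y) and its reverse. *)
Lemma code_color_exists (C : set X) (f : X * X -> nat) (es : seq (X * X)) :
  finite_set C -> (forall x y, f (x, y) = f (y, x)) ->
  (forall e, e \in es -> C e.1 /\ C e.2) ->
  exists p, forall e, e \in es -> code_color p e = f e.
Proof.
move=> fC fS; elim: es => [|[x y] es IH] Ces; first by exists [::].
have [|p pP] := IH; first by move=> e ee; apply: Ces; rewrite inE ee orbT.
have [i [Bx iU]] := base_isolate XB x fC.
have [j [By jU]] := base_isolate XB y fC.
exists ((i, j, f (x, y)) :: p) => -[x' y'] e'.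
have [/= Cx Cy] := Ces _ e'.
move: e'; rewrite inE /= => /orP[/eqP[-> ->]|e'].
  by rewrite asboolT //; left.
case: asboolP => [[[/= Bi Bj]|[/= Bj Bi]]|_]; last exact: pP.
  by rewrite (iU _ Cx Bi) (jU _ Cy Bj).
by rewrite (iU _ Cy Bi) (jU _ Cx Bj).
Qed.

End Codes.

Lemma finite_konig H d x : sym_graph H -> bipartite H ->
  finite_set (component H x) -> (forall y, degree_le H d y) ->
  exists f : X * X -> nat, (forall u v, f (u, v) = f (v, u)) /\
    forall u v, component H x u -> H (u, v) -> f (u, v) < d /\
      forall w, H (u, w) -> v <> w -> f (u, v) <> f (u, w).
Proof.
move=> sH bH fC dH; have [side sideP] := component_side x sH bH.
have [s sE] := (finite_seqP _).1 fC.
pose E := [seq e <- allpairs pair (undup s) (undup s) |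
  `[< H e >] && (side e.1 && ~~ side e.2)].
have EP u v : reflect [/\ component H x u, H (u, v), side u & ~~ side v]
    ((u, v) \in E).
  rewrite mem_filter; apply: (iffP andP) =>
    [[/andP[/asboolP ? /andP[? ?]]]|[xu uv su sv]].
    move=> /allpairsP[[u' v'] [/= us vs [? ?]]]; subst u' v'; split => //.
    by rewrite sE /= -mem_undup.
  have xv := component_edge xu uv.
  split; first by rewrite asboolT //= su.
  move: xu xv; rewrite sE /= => us vs.
  by apply/allpairsP; exists (u, v); rewrite /= !mem_undup.
have uE : uniq E.
  apply: filter_uniq; apply: allpairs_uniq; rewrite ?undup_uniq //.
  by move=> [a b] [a' b'] _ _ [/= -> ->].
have dL u : count (fun e => e.1 == u) E <= d.
  rewrite -size_filter -(size_map snd); apply: (dH u).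
    rewrite map_inj_in_uniq; first exact: filter_uniq uE.
    move=> [a b] [a' b'].
    by rewrite !mem_filter /= => /andP[/eqP -> _] /andP[/eqP -> _] ->.
  move=> y /mapP[[a b]]; rewrite mem_filter /= => /andP[/eqP -> /EP[_ ? _ _]].
  by move=> ->.
have dR v : count (fun e => e.2 == v) E <= d.
  rewrite -size_filter -(size_map fst); apply: (dH v).
    rewrite map_inj_in_uniq; first exact: filter_uniq uE.
    move=> [a b] [a' b'].
    by rewrite !mem_filter /= => /andP[/eqP -> _] /andP[/eqP -> _] ->.
  move=> y /mapP[[a b]]; rewrite mem_filter /= => /andP[/eqP -> /EP[_ ? _ _]].
  by move=> ->; exact: sH.
have [c cd cP] := konig uE dL dR.
(* König's theorem colors the edges oriented by [side]; reversed edges copy the color, and 0 is a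
   default for other pairs. *)
exists (fun e => if side e.1 == side e.2 then 0 else
                 if side e.1 then c e else c (e.2, e.1)); split.
  by move=> u v /=; rewrite eq_sym; case: (side u); case: (side v).
move=> u v xu uv /=; have xv := component_edge xu uv.
have suv := sideP u v xu uv; have vu := sH _ _ uv.
rewrite (negbTE suv).
have [su|su] := boolP (side u).
  have sv : ~~ side v by move: suv; rewrite su; case: (side v).
  split=> [|w uw vw]; first by apply: cd; apply/EP.
  have := sideP u w xu uw; rewrite su => sw; rewrite (negbTE sw) => cvw.
  have Euv : (u, v) \in E by apply/EP.
  have Euw : (u, w) \in E.
    by apply/EP; split => //; move: sw; case: (side w).
  by apply: vw; have [] := cP _ _ Euv Euw (or_introl erefl) cvw.
have sv : side v by move: suv; rewrite (negbTE su); case: (side v).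
split=> [|w uw vw]; first by apply: cd; apply/EP.
have := sideP u w xu uw; have xw := component_edge xu uw.
rewrite (negbTE su) => sw; rewrite (negbTE sw) => cvw.
have Evu : (v, u) \in E by apply/EP.
have Ewu : (w, u) \in E.
  by apply/EP; split => //; [exact: sH|move: sw; case: (side w)].
by apply: vw; have [] := cP _ _ Evu Ewu (or_intror erefl) cvw.
Qed.

(** Some code describes a König coloring of each finite component, and there are countably many
    codes. Each point uses the least code valid on its component; this choice is Borel and constant
    on components. *)
Lemma borel_konig H d : borel H -> sym_graph H -> bipartite H ->
  component_finite H -> (forall x, degree_le H d x) ->
  exists c, borel_edge_coloring H `I_d c.
Proof.
move=> bH sH biH cfH dH.
have [B XB] := polish_base x0 XP.
have [h [bh hH Hh]] := borel_enumeration x0 XP bH (component_finite_locally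
  cfH).
have walkP := walk_component _ _ hH Hh.
pose code n := odflt [::] (unpickle n) : seq (nat * nat * nat).
pose col n := code_color B (code n).
pose valid n := [set x | forall u v, component H x u -> H (u, v) ->
  col n (u, v) < d /\
  forall w, H (u, w) -> v <> w -> col n (u, v) <> col n (u, w)].
have bcol n k : borel [set e | col n e = k] by exact: code_color_borel.
have bvalid n : borel (valid n).
  have bw w : borel_fun (walk h w) by exact: walk_borel.
  have bw1 w i : borel_fun (fun x => (walk h w x, h i (walk h w x))).
    by apply: (borel_pair XB) => //; exact: borel_fun_comp (bw w) (bh i).
  (* All vertices and edges of the component are named by words and indices, so only countable
     quantifiers remain. *)
  rewrite (_ : valid n = [set x | forall w i, H (walk h w x,
    h i (walk h w x)) ->
    (exists k, k < d /\ col n (walk h w x, h i (walk h w x)) = k) /\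
    forall j, H (walk h w x, h j (walk h w x)) ->
      h i (walk h w x) <> h j (walk h w x) -> forall k,
      col n (walk h w x, h i (walk h w x)) = k ->
      ~ col n (walk h w x, h j (walk h w x)) = k]).
    apply: borel_forall => w; apply: borel_forall => i.
    apply: borel_imply; first exact: (borel_preimage (bw1 w i) bH).
    apply: borelI.
      apply: borel_exists => k; apply: borelI; first exact: borel_cst.
      exact: (borel_preimage (bw1 w i) (bcol n k)).
    apply: borel_forall => j.
    apply: borel_imply; first exact: (borel_preimage (bw1 w j) bH).
    apply: borel_imply.
      apply: (borel_neq XB); [exact: borel_fun_comp (bw w) (bh i)|].
      exact: borel_fun_comp (bw w) (bh j).
    apply: borel_forall => k; apply: borel_imply.
      exact: (borel_preimage (bw1 w i) (bcol n k)).
    apply: borelC; exact: (borel_preimage (bw1 w j) (bcol n k)).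
  apply/seteqP; split=> x /= V.
    move=> w i Hi; have [|lt ne] := V _ _ _ Hi; first by apply/walkP; exists w.
    split=> [|j Hj ij k ck ck']; first by eexists; split; [exact: lt|].
    by apply: (ne _ Hj ij); rewrite ck ck'.
  move=> u v /walkP[w ->] uv; have [i vi] := Hh _ _ uv; subst v.
  have [[k [kd /= ck]] ne] := V w i uv.
  split=> [|v uv' iv cv]; first by rewrite ck.
  have [j vj] := Hh _ _ uv'; subst v.
  exact: ne uv' iv _ erefl (esym cv).
have [x|first firstP] := @first_index X valid.
  have [f [fS fP]] := finite_konig sH biH (cfH x) dH.
  have [s sE] := (finite_seqP _).1 (cfH x).
  have [|p pP] := @code_color_exists B XB _ f (allpairs pair s s) (cfH x) fS.
    by move=> _ /allpairsP[[u v] [/= us vs ->]]; rewrite sE.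
  have cp u v : component H x u -> H (u, v) -> code_color B p (u, v) = f (u, v).
    move=> xu uv; apply: pP; apply/allpairsP; exists (u, v) => /=; split=> //.
      by move: xu; rewrite sE.
    by have := component_edge xu uv; rewrite sE.
  exists (pickle p) => u v xu uv; rewrite /col /code pickleK /= (cp _ _ xu uv).
  have [lt ne] := fP u v xu uv; split=> // w uw; rewrite (cp _ _ xu uw).
  exact: ne.
have first_edge x y : H (x, y) -> first x = first y.
  move=> xy; have [Vx nVx] := firstP x; have [Vy nVy] := firstP y.
  apply: (first_index_eq (P := valid^~ x) (Q := valid^~ y)) => // i.
  split=> V u v uc; apply: V.
    exact: component_edgel uc.
  by apply: component_edgel uc; exact: sH.
exists (fun e => col (first e.1) e); split.
- move=> k; rewrite (_ : _ `&` _ = H `&` [set e | exists n,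
    ((valid n `&` [set x | forall m, m < n -> ~ valid m x]) `*` setT) e /\
    col n e = k]).
    apply: borelI => //; apply: borel_exists => n; apply: borelI;
      last exact: bcol.
    apply: borel_fst; apply: borelI => //; apply: borel_forall => m.
    by apply: borel_imply; [exact: borel_cst|exact: borelC].
  apply/seteqP; split=> -[x y] [Hxy].
    move=> ck; split=> //; exists (first x).
    exact: (conj (conj (firstP x) I) ck).
  move=> [n [[/= [Vn nVn] _] nk]]; split=> //=; rewrite -nk; congr (col _ _).
  have [Vx nVx] := firstP x.
  exact: (first_index_eq (P := valid^~ x) (Q := valid^~ x)).
- move=> [x y] Hxy /=; have [V _] := firstP x.
  by have [] := V x y (component_refl _ _) Hxy.
- by move=> x y Hxy /=; rewrite (first_edge x y Hxy); exact: code_colorC.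
- move=> x y z Hxy Hxz yz /=; have [V _] := firstP x.
  by have [_] := V x y (component_refl _ _) Hxy; exact.
Qed.

End BorelGraphs.

(** * One more color for each set of the cover *)

Section Neighborhoods.
Variable X : choiceType.
Implicit Types (G H : set (X * X)) (A U : set X).

Definition thicken G A : set X := A `|` [set x | exists y, G (x, y) /\ A y].

Definition touching G A : set (X * X) := [set e | G e /\ (A e.1 \/ A e.2)].

Definition avoiding G A : set (X * X) := G `&` (~` A `*` ~` A).

Lemma iter_thicken_sub G A m : A `<=` iter m (thicken G) A.
Proof. by elim: m => // m IH x /IH; left. Qed.

Lemma touching_sub G H A U : H `<=` G -> A `<=` U ->
  touching H A `<=` touching G U.
Proof.
move=> HG AU e [He Ae]; split; first exact: HG.
by case: Ae => /AU; [left|right].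
Qed.

Lemma dist_leS G n x y z : G (x, y) -> dist_le G n y z -> dist_le G n.+1 x z.
Proof.
by move=> /adjP xy [p [yp pz sp]]; exists (y :: p); split; rewrite //= xy.
Qed.

Lemma dist_le_trans G m n x y z :
  dist_le G m x y -> dist_le G n y z -> dist_le G (m + n) x z.
Proof.
move=> [p [xp py sp]] [q [yq qz sq]]; exists (p ++ q); split.
- by rewrite cat_path xp py.
- by rewrite last_cat py.
- by rewrite size_cat leq_add.
Qed.

Lemma dist_le_sym G n x y : sym_graph G -> dist_le G n x y -> dist_le G n y x.
Proof.
move=> sG [p [xp <- sp]]; exists (rev (belast x p)); split.
- by rewrite rev_path; apply: sub_path xp => a b /adjP/sG/adjP.
- by case: p {xp sp} => //= z p; rewrite rev_cons last_rcons.
- by rewrite size_rev size_belast.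
Qed.

Lemma dist_le_mono G m n x y : m <= n -> dist_le G m x y -> dist_le G n x y.
Proof. by move=> mn [p [xp py sp]]; exists p; split=> //;
  exact: leq_trans mn. Qed.

Lemma ball_finite G n x :
  locally_finite G -> finite_set [set y | dist_le G n x y].
Proof.
move=> lG; elim: n x => [|n IH] x.
  apply: (sub_finite_set _ (finite_set1 x)) => y [p [_ <-]].
  by rewrite leqn0 size_eq0 => /eqP ->.
apply: (@sub_finite_set _ _ (x |` \bigcup_(y in neighbors G x) [set z | dist_le
  G n y z])).
  move=> y [[|z p] [/= xp zy sp]]; first by left.
  move: xp => /andP[/adjP xz zp]; right; exists z => //.
  by exists p.
rewrite finite_setU; split; first exact: finite_set1.
by apply: bigcup_finite => // z _; exact: IH.
Qed.

Lemma iter_thicken_near G U m x : iter m (thicken G) U x ->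
  exists2 u, U u & dist_le G m x u.
Proof.
elim: m x => [|m IH] x /=; first by exists x => //; exists [::].
move=> [/IH[u Uu xu]|[y [xy /IH[u Uu yu]]]]; exists u => //.
  exact: dist_le_mono xu.
exact: dist_leS yu.
Qed.

(** Every vertex of an edge touching the thickening is within m + 1 of U. Points of U chosen near
    consecutive vertices are at distance at most (m + 1) + 1 + (m + 1), so a path is shadowed by a
    walk in one finite component of the power of G on U. *)
Lemma touching_component_finite G U m r : sym_graph G -> locally_finite G ->
  component_finite (restrict_graph (graph_power G r) U) -> m.*2 + 3 <= r ->
  component_finite (touching G (iter m (thicken G) U)).
Proof.
move=> sG lG cU mr x; pose T := touching G (iter m (thicken G) U).
have nearl a b : T (a, b) -> exists2 u, U u & dist_le G m.+1 a u.
  move=> [Gab [/= /iter_thicken_near[u Uu au]|/= /iter_thicken_near[u Uu bu]]].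
    by exists u => //; exact: dist_le_mono au.
  by exists u => //; exact: dist_leS Gab bu.
have sT : sym_graph T by move=> a b [ab aU]; split; [exact: sG|case: aU; auto].
have walk p a u : U u -> dist_le G m.+1 a u -> path (adj T) a p ->
    exists2 u', component (restrict_graph (graph_power G r) U) u u' &
      dist_le G m.+1 (last a p) u'.
  elim: p a u => [|b p IH] a u Uu au /=.
    by exists u => //; exact: component_refl.
  move=> /andP[/adjP Tab bp]; have [v Uv bv] := nearl _ _ (sT _ _ Tab).
  have [v' vv' pv'] := IH _ _ Uv bv bp; exists v' => //.
  have [->//|uv] := pselect (u = v); apply: component_edgel vv'.
  split=> //; split=> //=.
  have := dist_le_trans (dist_le_sym sG au) (dist_leS Tab.1 bv).
  by apply: dist_le_mono; lia.
have [[u Uu xu]|nu] := pselect (exists2 u, U u & dist_le G m.+1 x u).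
  apply: (@sub_finite_set _ _ (\bigcup_(v in
      component (restrict_graph (graph_power G r) U) u)
      [set y | dist_le G m.+1 v y])).
    move=> _ [p [xp <-]]; have [v uv pv] := walk p x u Uu xu xp.
    by exists v => //; exact: dist_le_sym.
  by apply: bigcup_finite => // v _; exact: ball_finite.
apply: (sub_finite_set _ (finite_set1 x)) => y [[|z p] [/= xp <-]] //.
by case: nu; move: xp => /andP[/adjP/nearl[u Uu xu] _]; exists u.
Qed.

Lemma sub_graph_power G r : sym_graph G -> bipartite G -> 0 < r ->
  G `<=` graph_power G r.
Proof.
move=> sG bG r0 [x y] xy; split=> /=.
  by move=> xy'; subst y; exact: bipartite_irrefl xy.
exists [:: y]; split=> //=; by rewrite andbT; exact/adjP.
Qed.

Lemma card_le_degree G k x : (neighbors G x #<= `I_k)%card -> degree_le G k x.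
Proof.
move=> Gk s us sG.
have fG : finite_set (neighbors G x) by apply/finite_set_leP; exists k.
apply: leq_trans (geq_card_fset_set Gk); apply: uniq_leq_size => // y /sG Gy.
by rewrite in_fset_set // inE.
Qed.

End Neighborhoods.

(** * Extending a coloring at the cost of one color *)

Section Extension.
Variables (R : realType) (X : topologicalType) (x0 : X).
Hypothesis XP : polish_space R X.
Implicit Types (G H : set (X * X)) (A U W : set X).

Lemma coloring_sub G H K c : borel H -> H `<=` G ->
  borel_edge_coloring G K c -> borel_edge_coloring H K c.
Proof.
move=> bH HG [bc cK cC cP]; split.
- move=> k; rewrite -(setIidl HG) -setIA; exact: borelI.
- by move=> e /HG/cK.
- by move=> x y /HG/cC.
- by move=> x y z /HG xy /HG; exact: cP.
Qed.

Lemma borel_thicken G A : borel G -> locally_finite G -> borel A ->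
  borel (thicken G A).
Proof.
move=> bG lG bA.
have [g [bg gG Gg]] := borel_enumeration x0 XP bG lG.
rewrite (_ : thicken G A = A `|` [set x | exists n, (g n @^-1` A) x]).
  apply: borelU => //; apply: borel_exists => n.
  exact: (borel_preimage (bg n)).
apply/seteqP; split=> x [Ax|]; try by left.
  by move=> [y [/Gg[n ->] Ay]]; right; exists n.
move=> [n /= Agx]; have [e|xg] := gG n x; first by left; rewrite -e.
by right; exists (g n x).
Qed.

Lemma borel_touching G A : borel G -> borel A -> borel (touching G A).
Proof.
move=> bG bA; rewrite (_ : touching G A = G `&` (A `*` setT `|` setT `*` A)).
  apply: borelI => //; apply: borelU; [exact: borel_fst|exact: borel_snd].
apply/seteqP; split=> -[x y].
  by move=> [? [?|?]]; split => //; [left|right].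
by move=> [? [[? _]|[_ ?]]]; split => //; [left|right].
Qed.

Lemma borel_avoiding G A : borel G -> borel A -> borel (avoiding G A).
Proof. by move=> bG bA; apply: borelI => //; apply: borel_prod;
  exact: borelC. Qed.

(* A matching [P] which agrees away from [A] with the last color of [M], but
   covers the vertices of degree [k + 1] near [A]: those edges of a color
   class [Q] of a finite König coloring around [A], and those edges of the
   last color class of [M] which do not meet [Q]. A vertex covered by [M] but
   not by [P] is at distance at most 2 from [A], so H minus [P] satisfies the
   hypotheses for [k - 1] if [A] is replaced by its 2-neighborhood. *)
Lemma extend_coloring G k H A M : borel_graph G -> locally_finite G ->
  bipartite G -> borel H -> sym_graph H -> H `<=` G -> borel A ->
  component_finite (touching G (iter k.*2 (thicken G) A)) ->
  (forall x, degree_le H k.+1 x) -> (forall x, ~ A x -> degree_le H k x) ->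
  borel_edge_coloring (avoiding H A) `I_k M ->
  exists c, borel_edge_coloring H `I_k.+1 c.
Proof.
move=> [bG sG _] lG biG.
elim: k H A M => [|k IH] H A M bH sH HG bA cA dH dHA [bM Mk MC MP].
  (* For k = 0 all degrees are at most 1, so H is a matching. *)
  exists (fun=> 0); split=> //.
    by move=> j; apply: borelI => //; exact: borel_cst.
  move=> x y z xy xz yz; have := dH x [:: y; z].
  rewrite /= inE andbT; case: eqP => // _ /(_ isT) H2.
  by have : 2 <= 1 by apply: H2 => w; rewrite !inE => /orP[]/eqP ->.
have TG : touching H A `<=` touching G (iter k.+1.*2 (thicken G) A).
  by apply: touching_sub => //; exact: iter_thicken_sub.
have bT := borel_touching bH bA.
have sT : sym_graph (touching H A).
  by move=> x y [xy aU]; split; [exact: sH|case: aU; auto].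
have TH : touching H A `<=` H by move=> e [].
have [|||q [bq qk qC qP]] := borel_konig x0 XP (d := k.+2) bT sT.
- exact/(bipartite_sub TH)/(bipartite_sub HG).
- exact: component_finite_sub cA.
- by move=> x; exact: degree_le_sub (dH x).
pose Q := touching H A `&` q @^-1` [set 0].
have sQ : sym_graph Q by move=> x y [xy qxy]; split; [exact: sT|rewrite /= -qC].
have QP x y z : Q (x, y) -> Q (x, z) -> y = z.
  move=> [xy q0] [xz q0']; apply: contrapT => yz.
  by apply: (qP _ _ _ xy xz yz); rewrite q0 q0'.
pose V := [set x | exists y, Q (x, y)].
have VA x : V x -> thicken G A x.
  by move=> [y [[/HG xy [/= Ax|/= Ay]] _]]; [left|right; exists y].
have bQ : borel Q by exact: bq.
have QG : Q `<=` G by move=> e [/TH/HG].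
have bV : borel V.
  have [g [bg gQ Qg]] := borel_enumeration x0 XP bQ
    (fun x => sub_finite_set (fun y (Qy : Q (x, y)) => QG _ Qy) (lG x)).
  have [B XB] := polish_base x0 XP.
  rewrite (_ : V = [set x | exists n, ((fun x => (x, g n x)) @^-1` Q) x]).
    have bid : borel_fun (@id X) by move=> U /borel_open.
    apply: borel_exists => n.
    exact: (borel_preimage (borel_pair XB bid (bg n)) bQ).
  apply/seteqP; split=> x; last by move=> [n ?]; exists (g n x).
  by move=> [y xy]; have [n yn] := Qg _ _ xy; exists n; rewrite /= -yn.
pose N := avoiding H A `&` M @^-1` [set k].
pose P := Q `|` avoiding N V.
have bP : borel P by apply: borelU => //; apply: borel_avoiding => //;
  exact: bM.
have PH : P `<=` H by move=> e [[/TH]|[[[]]]].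
have sP : sym_graph P.
  move=> x y [/sQ|[[[xy [nx ny]] /= Mxy] [nVx nVy]]]; first by left.
  right; split=> //; split; last by rewrite /= -MC.
  by split=> //; exact: sH.
have PP x y z : P (x, y) -> P (x, z) -> y = z.
  move=> [xy|[[xy Mxy] [nVx nVy]]] [xz|[[xz Mxz] [nVx' nVz]]].
  - exact: QP xy xz.
  - by case: nVx'; exists y.
  - by case: nVx; exists z.
  - apply: contrapT => yz; apply: (MP _ _ _ xy xz yz).
    by rewrite Mxy Mxz.
pose A' := thicken G (thicken G A).
have bA' : borel A' by do 2!apply: borel_thicken => //.
pose H' := H `\` P.
have H'H : H' `<=` H by move=> e [].
have dP x y : P (x, y) -> forall j, degree_le H j.+1 x -> degree_le H' j x.
  move=> Pxy j dx s us sH'; rewrite -ltnS.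
  have := dx (y :: s); rewrite /= us andbT; apply.
    by apply/negP => /sH'[_]; apply.
  move=> z; rewrite inE => /orP[/eqP ->|/sH'[]//]; exact: PH.
have [||||||||c [bc ck cC cP]] := IH H' A' M.
- exact: borelD.
- by move=> x y [xy nxy]; split; [exact: sH|move=> /sP].
- by move=> e /H'H/HG.
- exact: bA'.
- by move: cA; rewrite doubleS !iterSr.
- move=> x; have [Ax|nA] := pselect (A x); last first.
    by apply: degree_le_sub (dHA x nA).
  have [[y Pxy]|nP] := pselect (exists y, P (x, y));
    first exact: dP Pxy _ (dH x).
  move=> s us sH'.
  have sT' y : y \in s -> touching H A (x, y) by move=> /sH'[? _]; split;
    [|left].
  (* All edges at x touch A and, as P misses x, none has q-color 0; this leaves k + 1 colors. *)
  rewrite -[k.+1]/(k.+2.-1) -(size_map (fun y => q (x, y))).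
  have -> : k.+2.-1 = size (iota 1 k.+1) by rewrite size_iota.
  apply: uniq_leq_size.
    rewrite map_inj_in_uniq // => y z ys zs qyz; apply: contrapT => yz.
    exact: qP (sT' _ ys) (sT' _ zs) yz qyz.
  move=> _ /mapP[y ys ->]; rewrite mem_iota add1n.
  have /= -> := qk _ (sT' _ ys); rewrite andbT lt0n; apply/eqP => q0.
  by apply: nP; exists y; left; split => //; exact: sT'.
- move=> x nA'.
  have nA : ~ A x by move=> Ax; apply: nA'; do 2!left.
  have [[y Pxy]|nP] := pselect (exists y, P (x, y)).
    exact: dP Pxy _ (dHA x nA).
  move=> s us sH'.
  have sA y : y \in s -> avoiding H A (x, y).
    move=> /sH'[xy _]; split=> //; split=> //= Ay.
    by apply: nA'; left; right; exists y; split => //; exact: HG.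
  have nV y : G (x, y) -> ~ V y by move=> xy /VA yA; apply: nA'; right;
    exists y.
  (* All edges of [H'] at x are colored by M, and one of color k would lie in P, since V lies within
     the 1-neighborhood of A; this leaves k colors. *)
  rewrite -(size_map (fun y => M (x, y))) -[k](size_iota 0);
    apply: uniq_leq_size.
    rewrite map_inj_in_uniq // => y z ys zs Myz; apply: contrapT => yz.
    exact: MP (sA _ ys) (sA _ zs) yz Myz.
  move=> _ /mapP[y ys ->]; rewrite mem_iota add0n leq0n /=.
  have := Mk _ (sA _ ys); rewrite /= ltnS leq_eqVlt => /orP[/eqP Mxy|//].
  case: nP; exists y; right; split; first by split=> //; exact: sA.
  split=> /=; first by move=> /VA xA; apply: nA'; left.
  by apply: nV; apply: HG; have [] := sA _ ys.
- have AA' : avoiding H' A' `<=` avoiding H A.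
    move=> [x y] [[xy _] [/= nx ny]]; split=> //.
    by split=> /= [Ax|Ay]; [apply: nx|apply: ny]; do 2!left.
  have bAv : borel (avoiding H' A') by apply: borel_avoiding => //;
    exact: borelD.
  have [bM' _ MC' MP'] := coloring_sub bAv AA' (And4 bM Mk MC MP).
  split=> // -[x y] xy; have := Mk _ (AA' _ xy); rewrite /= ltnS leq_eqVlt.
  move=> /orP[/eqP Mxy|//]; have [[_ nP] [/= nx ny]] := xy.
  case: nP; right; split; first by split=> //; exact: AA'.
  by split=> /= /VA ?; [apply: nx|apply: ny]; left.
exists (fun e => if `[< P e >] then k.+1 else c e); split.
- move=> j; rewrite (_ : _ `&` _ =
    (P `&` [set e | k.+1 = j]) `|` (H' `&` c @^-1` [set j])).
    by apply: borelU; [apply: borelI => //; exact: borel_cst|exact: bc].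
  apply/seteqP; split=> e /=.
    by move=> [He]; case: asboolP => Pe ej; [left|right].
  move=> [[Pe kj]|[[He nPe] ce]]; first by rewrite asboolT //; split => //;
    exact: PH.
  by rewrite asboolF.
- move=> e He /=; case: asboolP => // nPe; apply: ltnW; rewrite ltnS.
  by apply: (ck e); split.
- move=> x y xy; case: asboolP => [Pxy|nPxy].
    by rewrite asboolT //; exact: sP.
  by rewrite asboolF; [apply: cC|move=> /sP].
- move=> x y z xy xz yz; case: asboolP => [Pxy|nPxy];
  case: asboolP => [Pxz|nPxz].
  + by case: yz; exact: PP Pxy Pxz.
  + by have /= := ck (x, z) (conj xz nPxz) => + /esym e; rewrite e ltnn.
  + by have /= := ck (x, y) (conj xy nPxy) => + e; rewrite e ltnn.
  + exact: cP.
Qed.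

End Extension.

(** * Induction along the cover, and countable colorings *)

Section Main.
Variables (R : realType) (X : topologicalType) (x0 : X).
Hypothesis XP : polish_space R X.
Implicit Types (G H : set (X * X)) (A U W : set X).

Lemma borel_induced G U : borel G -> borel U -> borel (restrict_graph G U).
Proof. by move=> bG bU; apply: borelI => //; exact: borel_prod. Qed.

(** The edges in the union that avoid U lie inside W, where M colors them. The bound on r comes from
    the 2k-fold thickening of U: m = 2k in 2m + 3. *)
Lemma merge_coloring G k r U W M : borel_graph G -> locally_finite G ->
  bipartite G -> (forall x, degree_le G k x) -> borel U -> borel W ->
  component_finite (restrict_graph (graph_power G r) U) -> 4 * k + 3 <= r ->
  borel_edge_coloring (restrict_graph G W) `I_k M ->
  exists c, borel_edge_coloring (restrict_graph G (W `|` U)) `I_k.+1 c.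
Proof.
move=> gG lG biG dG bU bW cU kr MP; have [bG sG iG] := gG.
have bWU : borel (restrict_graph G (W `|` U)).
  by apply: borel_induced => //; exact: borelU.
have HG : restrict_graph G (W `|` U) `<=` G by move=> e [].
apply: (extend_coloring x0 XP (G := G) (k := k) (A := U) (M := M)) => //.
- by move=> x y [xy [? ?]]; split; [exact: sG|].
- by apply: (touching_component_finite (r := r)) => //; lia.
- by move=> x s us sH; apply: leqW; exact: degree_le_sub HG (dG x) s us sH.
- by move=> x _; exact: degree_le_sub HG (dG x).
- apply: coloring_sub MP; first exact: borel_avoiding.
  by move=> [x y] [[xy [/= [Wx|Ux] [Wy|Uy]]] [/= nx ny]]; split.
Qed.

Lemma finite_asi_coloring G d s : borel_graph G -> locally_finite G ->
  bipartite G -> (forall x, degree_le G d x) -> asi_le G s ->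
  exists c, borel_edge_coloring G `I_(d + s) c.
Proof.
(* One radius serves all steps, since none of them starts from more than d + s colors. *)
move=> gG lG biG dG /(_ (4 * (d + s) + 3))[U [bU UX cU]].
have [bG sG _] := gG.
pose W j := [set x | exists i : 'I_s.+1, i <= j /\ U i x].
have bW j : borel (W j).
  by apply: borel_exists => i; apply: borelI => //; exact: borel_cst.
suff Wc j : j <= s -> exists c,
  borel_edge_coloring (restrict_graph G (W j)) `I_(d + j) c.
  have [c cP] := Wc s (leqnn s); exists c;
    apply: coloring_sub cP => // -[x y] xy.
  have WT z : W s z.
    have : [set: X] z by []. rewrite -UX => -[i _ Uz].
    by exists i; split=> //; rewrite -ltnS.
  by split.
have sub1 V : restrict_graph G V `<=` G by move=> e [].
elim: j => [_|j IH js].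
  rewrite addn0; apply: (borel_konig x0 XP).
  - exact: borel_induced.
  - by move=> x y [xy [? ?]]; split; [exact: sG|].
  - exact: bipartite_sub biG.
  - apply: component_finite_sub (cU ord0) => e [Ge [W1 W2]]; split.
      apply: sub_graph_power => //; lia.
    have W0 z : W 0 z -> U ord0 z.
      move=> [i [i0 Uz]]; suff <- : i = ord0 by [].
      by apply/val_inj => /=; move: i0; rewrite leqn0 => /eqP.
    by split; exact: W0.
  - by move=> x; exact: degree_le_sub (dG x).
have [M MP] := IH (ltnW js).
have jI : j.+1 < s.+1 by [].
rewrite addnS.
have -> : W j.+1 = W j `|` U (Ordinal jI).
  apply/seteqP; split=> x.
    move=> [i [ij Ux]]; move: ij; rewrite leq_eqVlt => /orP[/eqP ij|ij].
      by right; suff <- : i = Ordinal jI by []; exact: val_inj.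
    by left; exists i.
  move=> [[i [ij Ux]]|Ux]; last by exists (Ordinal jI).
  by exists i; split=> //; exact: leqW.
apply: (merge_coloring (r := 4 * (d + s) + 3) gG lG biG _ _ _ _ _ MP) => //.
- by move=> x t ut tG; apply: leq_trans (dG x t ut tG) _; exact: leq_addr.
- by lia.
Qed.

(* The edges (x, y) with x in B i, y in B j, y = g n x and x = g m y form,
   together with their reverses, a matching if B i and B j are disjoint. *)
Lemma countable_coloring G : borel_graph G -> locally_finite G ->
  exists c, borel_edge_coloring G [set: nat] c.
Proof.
move=> [bG sG iG] lG; have [B XB] := polish_base x0 XP.
have [oB nB hX _] := XB.
have [g [bg gG Gg]] := borel_enumeration x0 XP bG lG.
pose E (t : nat * nat * nat * nat) (x y : X) := let: (n, m, i, j) := t in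
  [/\ B i x, B j y, y = g n x & x = g m y] /\ B i `&` B j = set0.
(* An edge gets the least k such that it lies, in one direction or the other, in the matching coded
   by k. *)
pose P k (e : X * X) := exists t, pickle t = k /\ (E t e.1 e.2 \/ E t e.2 e.1).
have [f fP] : exists f : X * X -> nat, forall e, G e ->
    P (f e) e /\ forall m, m < f e -> ~ P m e.
  have [|f fP] := @first_index (X * X)%type (fun k e => G e -> P k e).
    move=> [x y]; have [xy|] := pselect (G (x, y)); last by exists 0.
    have [n yn] := Gg _ _ xy; have [m xm] := Gg _ _ (sG _ _ xy).
    have [|U [V [oU oV Ux Vy UV]]] := @hausdorff_open _ x y hX.
      by move=> xy'; rewrite xy' in xy; exact: (iG _ xy).
    have [i [Bx BU]] := nB x U (open_nbhs_nbhs (conj oU Ux)).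
    have [j [By BV]] := nB y V (open_nbhs_nbhs (conj oV Vy)).
    exists (pickle (n, m, i, j)) => _; exists (n, m, i, j); split=> //.
    left; split=> //; rewrite -subset0 => z [Bi Bj].
    by apply: (UV z); [apply: BU|apply: BV]; exact: subset_closure.
  exists f => e Ge; have [Pe nPe] := fP e; split; first exact: Pe.
  by move=> m mf Pm; apply: (nPe m mf).
have bE (S : topologicalType) (a b : S -> X) t : borel_fun a -> borel_fun b ->
    borel [set e | E t (a e) (b e)].
  move: t => [[[n m] i] j] ba bb.
  have beq (u v : S -> X) :
    borel_fun u -> borel_fun v -> borel [set e | u e = v e].
    move=> bu bv; rewrite (_ : mkset _ = ~` [set e | u e <> v e]).
      by apply: borelC; exact: (borel_neq XB).
    by apply/seteqP; split=> e /=; [move=> ?; apply|exact: contrapT].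
  rewrite (_ : mkset _ = ((a @^-1` B i `&` b @^-1` B j) `&`
    ([set e | b e = g n (a e)] `&` [set e | a e = g m (b e)])) `&`
    [set _ | B i `&` B j = set0]).
    apply: borelI; last exact: borel_cst.
    apply: borelI; apply: borelI; [exact: ba|exact: bb|..].
      by apply: beq => //; exact: borel_fun_comp ba (bg n).
    by apply: beq => //; exact: borel_fun_comp bb (bg m).
  by apply/seteqP; split=> e /= => [[[? ? ? ?] ?]|[[[? ?] [? ?]] ?]].
have bfst : borel_fun (@fst X X) by apply: continuous_borel => ?;
  exact: cvg_fst.
have bsnd : borel_fun (@snd X X) by apply: continuous_borel => ?;
  exact: cvg_snd.
have bP k : borel (P k).
  apply: borel_exists => t; apply: borelI; first exact: borel_cst.
  by apply: borelU; exact: bE.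
have PC k x y : P k (x, y) -> P k (y, x).
  by move=> [t [tk [Et|Et]]]; exists t; split=> //; [right|left].
exists f; split=> //.
- move=> k; rewrite (_ : _ `&` _ =
    G `&` (P k `&` [set e | forall m, m < k -> ~ P m e])).
    apply: borelI => //; apply: borelI => //; apply: borel_forall => m.
    by apply: borel_imply; [exact: borel_cst|exact: borelC].
  apply/seteqP; split=> e.
    by move=> [Ge <-]; split=> //; exact: fP.
  move=> [Ge [Pk nPk]]; split=> //; have [Pf nPf] := fP e Ge.
  exact: (first_index_eq (P := P^~ e) (Q := P^~ e)).
- move=> x y xy; have [Pf nPf] := fP _ xy; have [Pf' nPf'] := fP _ (sG _ _ xy).
  apply: (first_index_eq (P := P^~ (x, y)) (Q := P^~ (y, x))) => // i.
  by split; exact: PC.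
- move=> x y z xy xz yz fyz; apply: yz.
  have [[t [tk Et]] _] := fP _ xy; have [[t' [tk' Et']] _] := fP _ xz.
  have {tk'} tt : t' = t by apply: (pcan_inj pickleK); rewrite tk' tk.
  subst t'; move: t {tk} Et Et' => [[[n m] i] j] /=.
  (* In the two mixed cases x would lie in both [B i] and [B j]; in the others, y and z are the same
     function of x. *)
  move=> [[[Bx By yx xy'] ij]|[[By Bx xy' yx] ij]]
    [[[Bx' Bz zx xz'] _]|[[Bz Bx' xz' zx] _]].
  + by rewrite yx zx.
  + by have : (B i `&` B j) x by []; rewrite ij.
  + by have : (B i `&` B j) x by []; rewrite ij.
  + by rewrite yx zx.
Qed.

End Main.

(** * Least cardinals and the final inequality *)

Lemma least_spec (P : nat -> Prop) : (exists n, P n) ->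
  P (least P) /\ forall m, P m -> least P <= m.
Proof.
move=> [n Pn]; have [f fP] := @first_index unit (fun k _ => P k)
  (fun _ => ex_intro _ n Pn).
have : exists k, P k /\ forall m, P m -> k <= m.
  have [Pk kmin] := fP tt; exists (f tt); split=> // m Pm.
  by rewrite leqNgt; apply/negP => /kmin.
by move=> /(xgetPex 0).
Qed.

Lemma least_card_fin (P : set nat -> Prop) n :
  P `I_n -> card_leq (least_card P) (Fin n).
Proof.
move=> Pn; have ex : exists n, P `I_n by exists n.
rewrite /least_card asboolT //=; exact: (least_spec ex).2.
Qed.

Lemma least_card_aleph0 (P : set nat -> Prop) :
  P [set: nat] -> card_leq (least_card P) Aleph0.
Proof.
move=> PT; rewrite /least_card; case: asboolP => //= _.
by rewrite asboolT.
Qed.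

Theorem theorem1p4 (R : realType) (X : topologicalType) (G : set (X * X)) :
  polish_space R X ->
  borel_graph G ->
  locally_finite G ->
  bipartite G ->
  finite_asi G ->
  card_leq (borel_edge_chromatic_number G)
           (card_add (max_degree G) (Fin (asi G))).
Proof.
move=> XP gG lG biG asiG.
have [fin_col ctbl_col] : (forall d s, (forall x, degree_le G d x) ->
      asi_le G s -> exists c, borel_edge_coloring G `I_(d + s) c) /\
    exists c, borel_edge_coloring G [set: nat] c.
  (* The constructions use a default point [x0]; on the empty space every coloring condition is
     vacuous. *)
  have [[x0 _]|X0] := pselect (exists x : X, True).
    split; last exact: (countable_coloring x0 XP).
    by move=> d s dG sG; exact: (finite_asi_coloring x0 XP).
  have X0G K : borel_edge_coloring G K (fun=> 0).
    split=> [k|[x]|x|x]; try by case: X0; exists x.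
    rewrite (_ : _ `&` _ = set0); first exact: borel0.
    by rewrite -subset0 => -[x] *; apply: X0; exists x.
  by split=> [d s _ _|]; exists (fun=> 0).
rewrite /max_degree /least_card.
case: asboolP => [ex|nex].
  have [dG _] := least_spec ex.
  apply: least_card_fin; apply: fin_col.
    by move=> x; exact: card_le_degree.
  exact: (least_spec asiG).1.
(* With unbounded finite degrees the right-hand side is [Aleph0]. *)
rewrite asboolT; last by move=> x; exact/finite_set_countable.
exact: least_card_aleph0.
Qed.
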